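(* Let $N\ge1$. The divergence-free aromatic bicomplex with $N$ nodes is exact if and only if $N\ne1$. Here ''exact'' means: $\operatorname{Im}(d_H|_{\widetilde\Omega_{n+1,p}^N})=\operatorname{Ker}(d_H|_{\widetilde\Omega_{n,p}^N})$ for all $n\ge1$, $p\ge0$; and $\operatorname{Im}(d_V|_{\widetilde\Omega_{n,p}^N})=\operatorname{Ker}(d_V|_{\widetilde\Omega_{n,p+1}^N})$ for all $n,p\ge0$, with $d_V$ injective on $\widetilde\Omega_{n,0}^N$ for all $n\ge 0$.
   Context: Aromatic forests. Let $V$ be a finite nonempty set of nodes and $E\subset V\times V$ a set of edges; an edge $(v,w)$ goes from $v$ to $w$ and then $v$ is a predecessor of $w$. Each node is the source of at most one edge; nodes with no outgoing edge are called roots. $V$ is split into vertices $V^\bullet$ and covertices $V^\circ$. The covertices are numbered $1,\dots,p$, the roots are numbered $1,\dots,n$, the vertices are not numbered. Such graphs, up to isomorphism preserving the vertex/covertex type and the numberings of covertices and roots, are called aromatic forests; $\mathcal F_{n,p}$ is the set of aromatic forests with $n$ roots and $p$ covertices, and $\mathcal F_{n,p}^N$ the subset of those with exactly $N$ nodes. Aromatic forms. The symmetric groups $S_n^\bullet$ and $S_p^\circ$ act on $\mathcal F_{n,p}$ by permuting the numbers of the roots, respectively covertices. Set $\wedge^\bullet\gamma=\frac1{n!}\sum_{\sigma\in S_n^\bullet}\varepsilon(\sigma)\sigma\gamma$, $\wedge^\circ\gamma=\frac1{p!}\sum_{\sigma\in S_p^\circ}\varepsilon(\sigma)\sigma\gamma$,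 $\wedge=\wedge^\bullet\wedge^\circ$, extended linearly. $\Omega_{n,p}=\wedge\operatorname{Span}_{\mathbb R}(\mathcal F_{n,p})$, $\Omega_{n,p}^N=\wedge\operatorname{Span}_{\mathbb R}(\mathcal F_{n,p}^N)$. Derivatives. For a root $r$ and a node $u$ (possibly $u=r$), $D^{r\to u}\gamma$ is $\gamma$ with the edge $(r,u)$ added, and $D^r\gamma=\sum_{u\in V}D^{r\to u}\gamma$. For $v\in V^\bullet$, $\gamma_{v\to c_k}$ is $\gamma$ with $v$ replaced by a covertex numbered $k$. For $\gamma\in\mathcal F_{n,p}$ with root number $n$ denoted $r_n$ ($n\ge1$), $d_H\gamma=D^{r_n}\gamma$ and $d_V\gamma=\wedge\sum_{v\in V^\bullet}\gamma_{v\to c_{p+1}}$; by linearity $d_H:\Omega_{n,p}^N\to\Omega_{n-1,p}^N$ ($n\ge1$), $d_V:\Omega_{n,p}^N\to\Omega_{n,p+1}^N$. Divergence-free version. A 1-loop is an edge $(v,v)$ ($v$ any node). Let $\mathcal A$ be the span of aromatic forests containing at least one 1-loop, $\mathcal A_{n,p}^N=\mathcal A\cap\Omega_{n,p}^N$, and $\widetilde\Omega_{n,p}^N=\Omega_{n,p}^N/\mathcal A_{n,p}^N$. The maps $d_H$ and $d_V$ send $\mathcal A$ to $\mathcal A$ and hence descend to maps $d_H:\widetilde\Omega_{n,p}^N\to\widetilde\Omega_{n-1,p}^N$ ($n\ge1$) and $d_V:\widetilde\Omega_{n,p}^N\to\widetilde\Omega_{n,p+1}^N$, which form the divergence-free aromatic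 bicomplex with $N$ nodes: rows $\cdots\to\widetilde\Omega_{2,p}^N\to\widetilde\Omega_{1,p}^N\to\widetilde\Omega_{0,p}^N$ and columns $0\to\widetilde\Omega_{n,0}^N\to\widetilde\Omega_{n,1}^N\to\cdots$. *)

(* Defs.v *)
From HB Require Import structures.
From mathcomp Require Import all_boot all_order all_fingroup all_algebra.
From mathcomp Require Import generic_quotient ring_quotient reals.

Set Implicit Arguments.
Unset Strict Implicit.
Unset Printing Implicit Defensive.

Import Order.TTheory GRing.Theory Num.Theory.
Local Open Scope ring_scope.
Local Open Scope quotient_scope.

(** Labelled graphs.  The node set is 'I_N: every graph with N nodes is
    isomorphic to one on 'I_N.  The edge set, in which each node is the source
    of at most one edge, is given by the partial function [target]. *)
Section Graphs.
Variables N n p : nat.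

Record graph := Graph {
  target : {ffun 'I_N -> option 'I_N};
  root : {ffun 'I_n -> 'I_N};
  covertex : {ffun 'I_p -> 'I_N}
}.

Definition graph_tuple (g : graph) := (target g, root g, covertex g).
Definition tuple_graph x := let: (t, r, c) := x in Graph t r c.
Lemma graph_tupleK : cancel graph_tuple tuple_graph. Proof. by case. Qed.
HB.instance Definition _ := Finite.copy graph (can_type graph_tupleK).

(** [root] numbers the nodes with no outgoing edge, each exactly once;
    [covertex] numbers the covertices, each exactly once. *)
Definition wf (g : graph) : bool :=
  [&& injectiveb (root g),
      [forall v, (v \in codom (root g)) == (target g v == None)]
    & injectiveb (covertex g)].

Record lforest := LForest { lgraph :> graph; lgraph_wf : wf lgraph }.
HB.instance Definition _ := [isSub for lgraph].
HB.instance Definition _ := [Finite of lforest by <:].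

Definition vertex (g : graph) := {v : 'I_N | v \notin codom (covertex g)}.

Definition has_loop (g : graph) : bool := [exists v, target g v == Some v].

Definition isomap (s : {perm 'I_N}) (g h : graph) : bool :=
  [&& [forall v, target h (s v) == omap s (target g v)],
      [forall i, root h i == s (root g i)]
    & [forall k, covertex h k == s (covertex g k)]].

Definition iso (g h : lforest) : bool := [exists s, isomap s g h].

Lemma isomapP (s : {perm 'I_N}) (g h : graph) : reflect
  [/\ forall v, target h (s v) = omap s (target g v),
      forall i, root h i = s (root g i)
    & forall k, covertex h k = s (covertex g k)] (isomap s g h).
Proof.
apply: (iffP and3P) => [[/'forall_eqP ? /'forall_eqP ? /'forall_eqP ?]|[? ? ?]];
  by split=> //; apply/'forall_eqP.
Qed.

Lemma wfP (g : graph) : reflect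
  [/\ injective (root g),
      forall v, (v \in codom (root g)) = (target g v == None)
    & injective (covertex g)] (wf g).
Proof.
apply: (iffP and3P) => [[/injectiveP ? /'forall_eqP ? /injectiveP ?]|[? ? ?]];
  by split=> //; first [exact/injectiveP|exact/'forall_eqP].
Qed.

Lemma iso_equiv : equiv_class_of iso.
Proof.
split=> [g|g h|h g k].
- by apply/existsP; exists 1%g; apply/isomapP; split=> [v|i|k]; rewrite ?perm1 //;
    case: (target g v) => //= w; rewrite perm1.
- have sub g' h' : iso g' h' -> iso h' g'.
    case/existsP=> s /isomapP[tE rE cE]; apply/existsP; exists (s^-1)%g.
    apply/isomapP; split=> [v|i|k]; rewrite ?rE ?cE ?permK //.
    rewrite -{2}[v](permKV s) tE.
    by case: (target g' _) => //= w; rewrite permK.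
  by apply/idP/idP; apply: sub.
- case/existsP=> s /isomapP[tE rE cE] /existsP[s' /isomapP[tE' rE' cE']].
  apply/existsP; exists (s * s')%g; apply/isomapP; split=> [v|i|j];
    rewrite ?permM ?rE' ?cE' ?rE ?cE ?tE' ?tE //.
  by case: (target g v) => //= w; rewrite permM.
Qed.

Canonical iso_equiv_rel := EquivRelPack iso_equiv.
Canonical iso_encModRel := defaultEncModRel iso.

(** The set of aromatic forests with N nodes, n roots and p covertices. *)
Definition forest := {eq_quot iso}.
HB.instance Definition _ := EqQuotient.on forest.
HB.instance Definition _ := Countable.on forest.
HB.instance Definition _ : isFinite forest := CanIsFinite (@reprK _ forest).

Definition fclass (g : lforest) : forest := \pi_forest g.

Lemma isoP (g h : lforest) :
  reflect (exists s, isomap s g h) (fclass g == fclass h).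
Proof. by rewrite eqmodE; apply: existsP. Qed.

Lemma fclassK : cancel repr fclass. Proof. exact: reprK. Qed.

Lemma iso_repr (g : lforest) : exists s, isomap s g (repr (fclass g)).
Proof. by apply/isoP; rewrite fclassK. Qed.

Lemma forest_ind (P : forest -> Prop) : (forall g, P (fclass g)) -> forall x, P x.
Proof. by move=> Pp x; rewrite -[x]fclassK. Qed.

(** [sigma] sends the root numbered [i] to the number [sigma i]. *)
Definition graph_actR (sigma : 'S_n) (g : graph) : graph :=
  Graph (target g) [ffun i => root g ((sigma^-1)%g i)] (covertex g).
Definition graph_actC (sigma : 'S_p) (g : graph) : graph :=
  Graph (target g) (root g) [ffun k => covertex g ((sigma^-1)%g k)].

Lemma actR_wf sigma (g : lforest) : wf (graph_actR sigma g).
Proof.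
have /wfP[ri rE ci] := lgraph_wf g; apply/wfP; split=> //= [i j|v].
  by rewrite !ffunE => /ri /perm_inj.
rewrite -rE; apply/codomP/codomP=> -[i ->].
  by rewrite ffunE; exists ((sigma^-1)%g i).
by exists (sigma i); rewrite ffunE permK.
Qed.
Lemma actC_wf sigma (g : lforest) : wf (graph_actC sigma g).
Proof.
have /wfP[ri rE ci] := lgraph_wf g; apply/wfP; split=> //= i j.
by rewrite !ffunE => /ci /perm_inj.
Qed.

Definition lactR sigma (g : lforest) := LForest (actR_wf sigma g).
Definition lactC sigma (g : lforest) := LForest (actC_wf sigma g).
Definition actR sigma (x : forest) : forest := fclass (lactR sigma (repr x)).
Definition actC sigma (x : forest) : forest := fclass (lactC sigma (repr x)).
Definition forest_has_loop (x : forest) : bool := has_loop (repr x).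

Lemma actR_pi sigma g : actR sigma (fclass g) = fclass (lactR sigma g).
Proof.
have [s /isomapP[tE rE cE]] := iso_repr g; apply/esym/eqP/isoP; exists s.
by apply/isomapP; split=> //= i; rewrite !ffunE.
Qed.

Lemma actC_pi sigma g : actC sigma (fclass g) = fclass (lactC sigma g).
Proof.
have [s /isomapP[tE rE cE]] := iso_repr g; apply/esym/eqP/isoP; exists s.
by apply/isomapP; split=> //= i; rewrite !ffunE.
Qed.

Lemma has_loop_pi (g : lforest) : forest_has_loop (fclass g) = has_loop g.
Proof.
have [s /isomapP[tE rE cE]] := iso_repr g; apply/existsP/existsP=> -[v /eqP vE].
  exists ((s^-1)%g v); move: vE; rewrite -{1}[v](permKV s) tE.
  by case: (target g _) => //= w [<-]; rewrite permK.
by exists (s v); rewrite tE vE.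
Qed.

End Graphs.

Arguments target {N n p}.
Arguments root {N n p}.
Arguments covertex {N n p}.

Section Derivatives.
Variables N n p : nat.

(** The edge from the last root to [u] is added. *)
Definition graph_graft (g : graph N n.+1 p) (u : 'I_N) : graph N n p :=
  Graph [ffun v => if v == root g ord_max then Some u else target g v]
        [ffun i => root g (lift ord_max i)] (covertex g).

Lemma graft_wf (g : lforest N n.+1 p) u : wf (graph_graft g u).
Proof.
have /wfP[ri rE ci] := lgraph_wf g; apply/wfP; split=> //= [i j|v].
  by rewrite !ffunE => /ri /lift_inj.
rewrite ffunE; case: (v =P root g ord_max) => [->|/eqP vN].
  apply/negP=> /codomP[i]; rewrite ffunE => /ri /eqP.
  by rewrite (negPf (neq_lift _ _)).
rewrite -rE; apply/codomP/codomP=> -[i vE].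
  by rewrite vE ffunE; exists (lift ord_max i).
case: (unliftP ord_max i) vE => [j ->|->] vE; last by rewrite vE eqxx in vN.
by exists j; rewrite ffunE.
Qed.

Definition graft (g : lforest N n.+1 p) u : lforest N n p :=
  LForest (graft_wf g u).

(** The vertex [v] is replaced by a covertex with the new last number. *)
Definition graph_mkcov (g : graph N n p) (v : vertex g) : graph N n p.+1 :=
  Graph (target g) (root g)
    [ffun k => if unlift ord_max k is Some j then covertex g j else val v].

Lemma mkcov_wf (g : lforest N n p) (v : vertex g) : wf (graph_mkcov v).
Proof.
have /wfP[ri rE ci] := lgraph_wf g; apply/wfP; split=> //= i j.
case: v => v /= vN; rewrite !ffunE.
case: (unliftP ord_max i) => [i' ->|->]; case: (unliftP ord_max j) => [j' ->|->] //=.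
- by move=> /ci ->.
- by move=> vE; case/negP: vN; rewrite -vE codom_f.
- by move=> vE; case/negP: vN; rewrite vE codom_f.
Qed.

Definition mkcov (g : lforest N n p) (v : vertex g) : lforest N n p.+1 :=
  LForest (mkcov_wf v).

End Derivatives.

(** The real vector space with basis the finite set [forest N n p]. *)
Definition span (R : realType) (N n p : nat) := {ffun forest N n p -> R^o}.

HB.lock Definition delta (R : realType) (N n p : nat) (x : forest N n p) :
  span R N n p := [ffun y => (y == x)%:R].

HB.lock Definition linext (R : realType) (N n p : nat) (W : lmodType R)
  (f : forest N n p -> W) (a : span R N n p) : W := \sum_x a x *: f x.

Arguments delta {R N n p}.
Arguments linext {R N n p W}.

Section Forms.
Variable R : realType.

Section Span.
Variables N n p : nat.
Local Notation span := (span R N n p).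

Lemma linext_is_linear (W : lmodType R) (f : forest N n p -> W) : linear (linext f).
Proof.
move=> c a b; rewrite linext.unlock scaler_sumr -big_split; apply: eq_bigr => x _ /=.
by rewrite !ffunE scalerDl scalerA.
Qed.
HB.instance Definition _ (W : lmodType R) (f : forest N n p -> W) :=
  GRing.isLinear.Build R span W *:%R (linext f) (linext_is_linear f).

Lemma linext_delta (W : lmodType R) (f : forest N n p -> W) x : linext f (delta x) = f x.
Proof.
rewrite linext.unlock delta.unlock (bigD1 x) //= big1 ?addr0 => [|y yx]; rewrite ffunE.
  by rewrite eqxx scale1r.
by rewrite (negPf yx) scale0r.
Qed.

Lemma span_sum (a : span) : a = linext delta a.
Proof.
apply/ffunP=> y; rewrite linext.unlock delta.unlock sum_ffunE (bigD1 y) //= big1 ?addr0 => [|x xy].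
  by rewrite !ffunE eqxx /GRing.scale /= mulr1.
by rewrite !ffunE eq_sym (negPf xy) scaler0.
Qed.

Lemma eq_on_delta (W : lmodType R) (f g : {linear span -> W}) :
  (forall x, f (delta x) = g (delta x)) -> f =1 g.
Proof.
move=> fg a; rewrite [a]span_sum linext.unlock !linear_sum; apply: eq_bigr => x _.
by rewrite !linearZ fg.
Qed.

Definition spanR (sigma : 'S_n) : span -> span :=
  linext (fun x => delta (actR sigma x)).
Definition spanC (sigma : 'S_p) : span -> span :=
  linext (fun x => delta (actC sigma x)).
HB.instance Definition _ sigma := GRing.Linear.on (spanR sigma).
HB.instance Definition _ sigma := GRing.Linear.on (spanC sigma).

Definition altR (a : span) : span :=
  n`!%:R^-1 *: \sum_(sigma : 'S_n) (-1) ^+ sigma *: spanR sigma a.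
Definition altC (a : span) : span :=
  p`!%:R^-1 *: \sum_(sigma : 'S_p) (-1) ^+ sigma *: spanC sigma a.
Definition wedge (a : span) : span := altR (altC a).

Lemma altR_is_linear : linear altR.
Proof.
move=> c a b; rewrite /altR scalerA mulrC -scalerA -scalerDr; congr (_ *: _).
rewrite scaler_sumr -big_split; apply: eq_bigr => s _ /=.
by rewrite linearP scalerDr !scalerA mulrC.
Qed.
HB.instance Definition _ := GRing.isLinear.Build R span span *:%R altR altR_is_linear.

Lemma altC_is_linear : linear altC.
Proof.
move=> c a b; rewrite /altC scalerA mulrC -scalerA -scalerDr; congr (_ *: _).
rewrite scaler_sumr -big_split; apply: eq_bigr => s _ /=.
by rewrite linearP scalerDr !scalerA mulrC.
Qed.
HB.instance Definition _ := GRing.isLinear.Build R span span *:%R altC altC_is_linear.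

Lemma wedge_is_linear : linear wedge.
Proof. by move=> c a b; rewrite /wedge !linearP. Qed.
HB.instance Definition _ := GRing.isLinear.Build R span span *:%R wedge wedge_is_linear.

Definition Omega : {vspace span} := limg (linfun wedge).

Definition loop_span : {vspace span} :=
  <<[seq delta x | x in @forest_has_loop N n p]>>%VS.

Lemma spanR_delta sigma x : spanR sigma (delta x) = delta (actR sigma x).
Proof. exact: linext_delta. Qed.
Lemma spanC_delta sigma x : spanC sigma (delta x) = delta (actC sigma x).
Proof. exact: linext_delta. Qed.

Lemma spanRM s t a : spanR t (spanR s a) = spanR (s * t)%g a.
Proof.
apply: (eq_on_delta (f := spanR t \o spanR s)) a => x /=.
rewrite !spanR_delta; congr delta; elim/forest_ind: x => g.
rewrite !actR_pi; congr fclass; apply: val_inj => /=.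
by congr Graph; apply/ffunP=> i; rewrite !ffunE invMg permM.
Qed.
Lemma spanCM s t a : spanC t (spanC s a) = spanC (s * t)%g a.
Proof.
apply: (eq_on_delta (f := spanC t \o spanC s)) a => x /=.
rewrite !spanC_delta; congr delta; elim/forest_ind: x => g.
rewrite !actC_pi; congr fclass; apply: val_inj => /=.
by congr Graph; apply/ffunP=> i; rewrite !ffunE invMg permM.
Qed.
Lemma spanRC s t a : spanR s (spanC t a) = spanC t (spanR s a).
Proof.
apply: (eq_on_delta (f := spanR s \o spanC t) (g := spanC t \o spanR s)) a => x /=.
rewrite spanC_delta !spanR_delta spanC_delta; congr delta.
elim/forest_ind: x => g; rewrite actC_pi !actR_pi actC_pi.
by congr fclass; apply: val_inj.
Qed.

Lemma sgnK (b : bool) (v : span) : (-1) ^+ b *: ((-1) ^+ b *: v) = v.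
Proof. by rewrite scalerA -expr2 sqrr_sign scale1r. Qed.

Lemma spanR_altR t a : spanR t (altR a) = (-1) ^+ t *: altR a.
Proof.
rewrite /altR linearZ /= scalerA mulrC -scalerA; congr (_ *: _).
rewrite linear_sum scaler_sumr [RHS](reindex_inj (mulIg t)) /=.
apply: eq_bigr => s _.
by rewrite linearZ /= spanRM odd_permM signr_addb mulrC -scalerA sgnK.
Qed.
Lemma spanC_altC t a : spanC t (altC a) = (-1) ^+ t *: altC a.
Proof.
rewrite /altC linearZ /= scalerA mulrC -scalerA; congr (_ *: _).
rewrite linear_sum scaler_sumr [RHS](reindex_inj (mulIg t)) /=.
apply: eq_bigr => s _.
by rewrite linearZ /= spanCM odd_permM signr_addb mulrC -scalerA sgnK.
Qed.
Lemma spanC_altR t a : spanC t (altR a) = altR (spanC t a).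
Proof.
rewrite /altR linearZ linear_sum; congr (_ *: _); apply: eq_bigr => s _.
by rewrite linearZ /= spanRC.
Qed.

Lemma OmegaP a : reflect
  ((forall s, spanR s a = (-1) ^+ s *: a) /\ (forall s, spanC s a = (-1) ^+ s *: a))
  (a \in Omega).
Proof.
apply: (iffP memv_imgP) => [[b _ ->]|[aR aC]].
  rewrite lfunE /=; split=> s; first exact: spanR_altR.
  by rewrite spanC_altR spanC_altC linearZ.
exists a; first exact: memvf.
have fN0 m : m`!%:R != 0 :> R by rewrite pnatr_eq0 -lt0n fact_gt0.
have -> : linfun wedge a = wedge a by rewrite lfunE.
have -> : wedge a = altR a.
  congr altR; rewrite /altC; under eq_bigr do rewrite aC sgnK.
  by rewrite sumr_const card_Sn -scaler_nat scalerA mulVf ?scale1r.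
rewrite /altR; under eq_bigr do rewrite aR sgnK.
by rewrite sumr_const card_Sn -scaler_nat scalerA mulVf ?scale1r.
Qed.

Lemma delta_loop x : forest_has_loop x -> delta x \in loop_span.
Proof.
by move=> xl; apply: memv_span; apply/imageP; exists x.
Qed.

Lemma loop_ind (W : vectType R) (f : {linear span -> W}) (U : {vspace W}) :
  (forall x, forest_has_loop x -> f (delta x) \in U) ->
  forall a, a \in loop_span -> f a \in U.
Proof.
move=> fU a /coord_span ->; rewrite linear_sum; apply: memv_suml => i _.
rewrite linearZ; apply: memvZ.
pose X : seq span := [seq delta x | x in @forest_has_loop N n p].
have /imageP[x xl ->] : X`_i \in X by apply: mem_nth; rewrite size_image.
exact: fU.
Qed.

Lemma wedge_loop a : a \in loop_span -> wedge a \in loop_span.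
Proof.
move: a; apply: (loop_ind (f := wedge)) => x xl.
rewrite /= /wedge /altC linearZ memvZ // linear_sum memv_suml // => s _.
rewrite linearZ memvZ //= spanC_delta /altR memvZ // memv_suml // => t _.
rewrite memvZ // spanR_delta delta_loop //.
elim/forest_ind: x xl => g; rewrite actC_pi actR_pi !has_loop_pi.
by [].
Qed.

End Span.

Section Differentials.
Variables N n p : nat.

(** [forest_dH_pi] and [forest_dV_pi] show that the choice of a representative
    is immaterial. *)
Definition forest_dH (x : forest N n.+1 p) : span R N n p :=
  \sum_(u : 'I_N) delta (fclass (graft (repr x) u)).
Definition dH : span R N n.+1 p -> span R N n p := linext forest_dH.
HB.instance Definition _ := GRing.Linear.on dH.

Definition forest_dV (x : forest N n p) : span R N n p.+1 :=
  wedge (\sum_(v : vertex (repr x)) delta (fclass (mkcov v))).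
Definition dV : span R N n p -> span R N n p.+1 := linext forest_dV.
HB.instance Definition _ := GRing.Linear.on dV.

Lemma forest_dH_pi (g : lforest N n.+1 p) :
  forest_dH (fclass g) = \sum_(u : 'I_N) delta (fclass (graft g u)).
Proof.
rewrite /forest_dH; have [s] := iso_repr g; move: (repr _) => h /isomapP[tE rE cE].
rewrite [LHS](reindex_inj (@perm_inj _ s)); apply: eq_bigr => u _.
congr delta; apply/esym/eqP/isoP; exists s; apply/isomapP.
split=> //= [v|i]; rewrite !ffunE ?rE //.
by rewrite (inj_eq perm_inj) tE; case: ifP.
Qed.

Lemma forest_dV_pi (g : lforest N n p) :
  forest_dV (fclass g) = wedge (\sum_(v : vertex g) delta (fclass (mkcov v))).
Proof.
rewrite /forest_dV; have [s] := iso_repr g; move: (repr _) => h /isomapP[tE rE cE].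
have sv (v : vertex g) : s (val v) \notin codom (covertex h).
  apply: contra (valP v) => /codomP[k]; rewrite cE => /perm_inj ->.
  exact: codom_f.
have sw (w : vertex h) :
    (s^-1)%g (val w) \notin codom (covertex g).
  apply: contra (valP w) => /codomP[k] wE; apply/codomP; exists k.
  by rewrite cE -wE permKV.
congr wedge; rewrite (reindex (fun v : vertex g => (exist _ (s (val v)) (sv v) : vertex h))) /=.
  apply: eq_bigr => v _; congr delta; apply/esym/eqP/isoP; exists s; apply/isomapP.
  by split=> //= k; rewrite !ffunE; case: (unlift ord_max k).
exists (fun w : vertex h => (exist _ ((s^-1)%g (val w)) (sw w) : vertex g)) => v _; apply: val_inj => /=.
  by rewrite permK.
by rewrite permKV.
Qed.

Lemma dH_delta x : dH (delta x) = forest_dH x.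
Proof. exact: linext_delta. Qed.
Lemma dV_delta x : dV (delta x) = forest_dV x.
Proof. exact: linext_delta. Qed.

Lemma dH_spanR (s : 'S_n) a :
  dH (spanR (lift_perm ord_max ord_max s) a) = spanR s (dH a).
Proof.
set t := lift_perm _ _ s.
apply: (eq_on_delta (f := dH \o spanR t) (g := spanR s \o dH)) a => x /=.
rewrite spanR_delta !dH_delta; elim/forest_ind: x => g.
rewrite actR_pi !forest_dH_pi linear_sum; apply: eq_bigr => u _.
rewrite [RHS]spanR_delta actR_pi; congr delta; congr fclass; apply: val_inj => /=.
congr Graph; apply/ffunP=> i; rewrite !ffunE /= ?ffunE /t lift_permV ?lift_perm_id //.
by rewrite lift_perm_lift.
Qed.

Lemma dH_spanC s a : dH (spanC s a) = spanC s (dH a).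
Proof.
apply: (eq_on_delta (f := dH \o spanC s) (g := spanC s \o dH)) a => x /=.
rewrite spanC_delta !dH_delta; elim/forest_ind: x => g.
rewrite actC_pi !forest_dH_pi linear_sum; apply: eq_bigr => u _.
by rewrite [RHS]spanC_delta actC_pi; congr delta; congr fclass; apply: val_inj.
Qed.

Lemma dH_Omega a : a \in Omega N n.+1 p -> dH a \in Omega N n p.
Proof.
case/OmegaP=> aR aC; apply/OmegaP; split=> s.
  by rewrite -dH_spanR aR linearZ odd_lift_perm /= addbb.
by rewrite -dH_spanC aC linearZ.
Qed.

Lemma dV_Omega a : dV a \in Omega N n p.+1.
Proof.
rewrite /dV linext.unlock memv_suml // => x _; rewrite memvZ //.
by apply/memv_imgP; eexists; [exact: memvf|rewrite lfunE].
Qed.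

Lemma dH_loop a : a \in loop_span N n.+1 p -> dH a \in loop_span N n p.
Proof.
move: a; apply: (loop_ind (f := dH)) => x; rewrite [X in X \in _]dH_delta.
elim/forest_ind: x => g; rewrite has_loop_pi forest_dH_pi => gl.
rewrite memv_suml // => u _; rewrite delta_loop // has_loop_pi.
have /wfP[_ rE _] := lgraph_wf g.
case/existsP: gl => v vl; apply/existsP; exists v; rewrite ffunE.
case: (v =P root g ord_max) => // vr; move: (rE v).
by rewrite (eqP vl) vr codom_f.
Qed.

Lemma dV_loop a : a \in loop_span N n p -> dV a \in loop_span N n p.+1.
Proof.
move: a; apply: (loop_ind (f := dV)) => x; rewrite [X in X \in _]dV_delta.
elim/forest_ind: x => g; rewrite has_loop_pi forest_dV_pi => gl.
by rewrite wedge_loop // memv_suml // => v _; rewrite delta_loop // has_loop_pi.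
Qed.

End Differentials.

Section DivergenceFree.
Variables N n p : nat.

Definition loop_forms : {pred subvs_of (Omega N n p)} :=
  fun a => vsval a \in (loop_span N n p :&: Omega N n p)%VS.

Lemma loop_formsE a : (a \in loop_forms) = (vsval a \in loop_span N n p).
Proof. by rewrite unfold_in memv_cap subvsP andbT. Qed.

Lemma loop_forms_closed : zmod_closed loop_forms.
Proof.
by split=> [|a b]; rewrite !loop_formsE ?linear0 ?mem0v // linearB; apply: memvB.
Qed.
HB.instance Definition _ :=
  GRing.isZmodClosed.Build _ loop_forms loop_forms_closed.

(** The quotient of the space of forms by its subspace of forms in the span
    of the forests with a 1-loop. *)
Definition DFOmega := Quotient.quot loop_forms.
HB.instance Definition _ := GRing.Zmodule.on DFOmega.
HB.instance Definition _ := EqQuotient.on DFOmega.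

Lemma DFOmega_eq (a b : subvs_of (Omega N n p)) :
  (\pi_DFOmega a == \pi_DFOmega b) = (vsval a - vsval b \in loop_span N n p).
Proof. by rewrite -Quotient.idealrBE loop_formsE linearB. Qed.

Lemma DFOmega_ind (P : DFOmega -> Prop) :
  (forall a, P (\pi_DFOmega a)) -> forall x, P x.
Proof. by move=> Pp x; rewrite -[x]reprK. Qed.

Lemma pi_DFOmegaD (a b : subvs_of (Omega N n p)) :
  \pi_DFOmega (a + b) = \pi_DFOmega a + \pi_DFOmega b.
Proof. exact: (raddfD (\pi_(Quotient.quot loop_forms))). Qed.

Definition DFscale (c : R) (x : DFOmega) : DFOmega :=
  \pi_DFOmega (c *: repr x).

Lemma DFscale_pi c a : DFscale c (\pi_DFOmega a) = \pi_DFOmega (c *: a).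
Proof.
have l : vsval (repr (\pi_DFOmega a)) - vsval a \in loop_span N n p.
  by rewrite -DFOmega_eq reprK.
by apply/eqP; rewrite DFOmega_eq; have := memvZ c l; rewrite scalerBr !linearZ.
Qed.

Lemma DFscaleA c d x : DFscale c (DFscale d x) = DFscale (c * d) x.
Proof. by elim/DFOmega_ind: x => a; rewrite !DFscale_pi scalerA. Qed.
Lemma DFscale1 : left_id 1 DFscale.
Proof. by elim/DFOmega_ind=> a; rewrite DFscale_pi scale1r. Qed.
Lemma DFscaleDr : right_distributive DFscale +%R.
Proof.
move=> c; elim/DFOmega_ind=> a; elim/DFOmega_ind=> b.
by rewrite -pi_DFOmegaD !DFscale_pi -pi_DFOmegaD scalerDr.
Qed.
Lemma DFscaleDl x : {morph DFscale^~ x : c d / c + d}.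
Proof.
by elim/DFOmega_ind: x => a c d; rewrite !DFscale_pi -pi_DFOmegaD scalerDl.
Qed.
HB.instance Definition _ := GRing.Zmodule_isLmodule.Build R DFOmega
  DFscaleA DFscale1 DFscaleDr DFscaleDl.

Lemma pi_DFOmegaP c (a b : subvs_of (Omega N n p)) :
  \pi_DFOmega (c *: a + b) = c *: \pi_DFOmega a + \pi_DFOmega b.
Proof. by rewrite pi_DFOmegaD -DFscale_pi. Qed.

End DivergenceFree.

Section DFDifferentials.
Variables N n p : nat.

Definition Omega_dH (a : subvs_of (Omega N n.+1 p)) : subvs_of (Omega N n p) :=
  Subvs (dH_Omega (subvsP a)).
Definition Omega_dV (a : subvs_of (Omega N n p)) : subvs_of (Omega N n p.+1) :=
  Subvs (dV_Omega (vsval a)).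

(** The induced maps on the quotients, see [df_dH_pi] and [df_dV_pi]. *)
Definition df_dH (a : DFOmega N n.+1 p) : DFOmega N n p :=
  \pi_(DFOmega N n p) (Omega_dH (repr a)).
Definition df_dV (a : DFOmega N n p) : DFOmega N n p.+1 :=
  \pi_(DFOmega N n p.+1) (Omega_dV (repr a)).

Lemma df_dH_pi a : df_dH (\pi_(DFOmega N n.+1 p) a) = \pi_(DFOmega N n p) (Omega_dH a).
Proof.
have l : vsval (repr (\pi_(DFOmega N n.+1 p) a)) - vsval a \in loop_span N n.+1 p.
  by rewrite -DFOmega_eq reprK.
by apply/eqP; rewrite DFOmega_eq; have := dH_loop l; rewrite linearB.
Qed.

Lemma df_dV_pi a : df_dV (\pi_(DFOmega N n p) a) = \pi_(DFOmega N n p.+1) (Omega_dV a).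
Proof.
have l : vsval (repr (\pi_(DFOmega N n p) a)) - vsval a \in loop_span N n p.
  by rewrite -DFOmega_eq reprK.
by apply/eqP; rewrite DFOmega_eq; have := dV_loop l; rewrite linearB.
Qed.

Lemma df_dH_is_linear : linear df_dH.
Proof.
move=> c; elim/DFOmega_ind=> a; elim/DFOmega_ind=> b.
rewrite -pi_DFOmegaP !df_dH_pi -pi_DFOmegaP; congr (\pi_(_) _).
by apply: val_inj; rewrite /= !linearP.
Qed.
HB.instance Definition _ :=
  GRing.isLinear.Build R (DFOmega N n.+1 p) (DFOmega N n p) *:%R df_dH
    df_dH_is_linear.

Lemma df_dV_is_linear : linear df_dV.
Proof.
move=> c; elim/DFOmega_ind=> a; elim/DFOmega_ind=> b.
rewrite -pi_DFOmegaP !df_dV_pi -pi_DFOmegaP; congr (\pi_(_) _).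
by apply: val_inj; rewrite /= !linearP.
Qed.
HB.instance Definition _ :=
  GRing.isLinear.Build R (DFOmega N n p) (DFOmega N n p.+1) *:%R df_dV
    df_dV_is_linear.

End DFDifferentials.

Definition horizontally_exact (N : nat) : Prop :=
  forall (n p : nat) (a : DFOmega N n.+1 p),
    (exists b : DFOmega N n.+2 p, df_dH b = a) <-> df_dH a = 0.

Definition vertically_exact (N : nat) : Prop :=
  forall n : nat,
    injective (@df_dV N n 0) /\
    forall (p : nat) (a : DFOmega N n p.+1),
      (exists b : DFOmega N n p, df_dV b = a) <-> df_dV a = 0.

Definition bicomplex_exact (N : nat) : Prop :=
  horizontally_exact N /\ vertically_exact N.

End Forms.

(* Main.v *)
From mathcomp Require Import all_boot all_order all_fingroup all_algebra.
From mathcomp Require Import generic_quotient ring_quotient reals.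
Require Import Defs.

(** The nodes of a graph on N labelled nodes are independent of one another: to
    give a graph is to say for each node that it is a root, or where its edge
    goes.  On labelled graphs without 1-loops the horizontal complex is therefore
    a tensor product over the nodes v of the two-term complexes
<<
      <v is a root>  -->  span of the targets u <> v,    root |-> sum of the u.
>>
    For N > 1 this map is injective, so each factor, and hence the product, has
    homology only in the degree without roots, which is horizontal exactness.
    For N = 1 the only target would be a 1-loop, the map is zero, and the
    one-node forest is a cycle that is not a boundary.

    Concretely, a form is represented by its coefficient function on labelled
    graphs, alternating under renumbering of the roots and of the covertices
    ([alternating]).  On such functions d_H becomes [cut_sum]: the coefficient
    at g is a sum over the non-roots w of g of the coefficient at g with the edge
    out of w deleted.  For a fixed node v, grafting v back to all u <> v and
    dividing by N - 1 gives an operator [uproot v] for which d h + h d is the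
    identity on the graphs where v is a root, and the average over the targets
    of v elsewhere ([uproot_homotopy_root], [cut_uproot_nonroot]).  Subtracting
    d h from a cycle thus makes it vanish wherever v is a root, and keeps it zero
    wherever it was zero because of its roots.  After all nodes have been treated,
    a cycle in degree n > 0 has become 0 ([clear_roots]).

    Vertically, d_V is up to a factor the alternating sum [uncov_sum] of
    turning a covertex back into a vertex, and turning a vertex into the
    last covertex, [mkcov_sum], is a homotopy: d h + h d = N
    ([vertical_homotopy]).  This is exact for every N > 0.

    Neither homotopy has to respect isomorphism of graphs.  A form is spread
    evenly over the labelled graphs of each isomorphism class ([spread]), the
    homotopies are applied there, and the result is summed over the classes
    again ([push]).  Summation over classes commutes with the differentials
    ([dH_push], [dV_push]) and is injective on isomorphism-invariant functions
    ([iso_inv_coef]), so cycles modulo 1-loops correspond to functions whose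
    differential vanishes on the graphs without 1-loops ([push_loop],
    [push_loop_inv]). *)

Set Implicit Arguments.
Unset Strict Implicit.
Unset Printing Implicit Defensive.

Import Order.TTheory GRing.Theory Num.Theory.
Local Open Scope ring_scope.

(** * Labelled graphs and elementary moves *)

Lemma graph_eq N n p (g h : graph N n p) :
  target g =1 target h -> root g =1 root h -> covertex g =1 covertex h -> g = h.
Proof.
by case: g h => t r c [t' r' c'] /= /ffunP-> /ffunP-> /ffunP->.
Qed.

Lemma perm_fix_max m (s : 'S_m.+1) :
  s ord_max = ord_max -> exists t, s = lift_perm ord_max ord_max t.
Proof.
move=> sm.
have P i : exists j, s (lift ord_max i) == lift ord_max j.
  case: (unliftP ord_max (s (lift ord_max i))) => [j ->|]; first by exists j.
  by rewrite -{2}sm => /perm_inj /eqP; rewrite eq_sym (negPf (neq_lift _ _)).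
pose f i := xchoose (P i).
have fE i : s (lift ord_max i) = lift ord_max (f i) by apply/eqP/(xchooseP (P i)).
have fi : injective f.
  by move=> i j fij; apply/(@lift_inj _ ord_max)/(@perm_inj _ s); rewrite !fE fij.
exists (perm fi); apply/permP=> i; case: (unliftP ord_max i) => [j ->|->].
  by rewrite lift_perm_lift permE fE.
by rewrite lift_perm_id.
Qed.

Section Insertion.
Variables (R : comPzRingType) (m : nat) (X : Type) (act : 'S_m.+1 -> X -> X).
Hypothesis actM : forall s t x, act t (act s x) = act (s * t)%g x.

(** Alternation of a function in one more number.  Only the permutations fixing
    the last number act on [F] by the sign; the transpositions
    [tperm k ord_max] represent their cosets, and renumbering by [s] permutes
    these cosets by k |-> s k.  The action is abstract because this serves
    roots as well as covertices. *)
Lemma insert_act (F : X -> R) (s : 'S_m.+1) x :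
  (forall (t : 'S_m) y,
      F (act (lift_perm ord_max ord_max t) y) = (-1) ^+ t * F y) ->
  \sum_k (-1) ^+ (k != ord_max) * F (act (tperm k ord_max) (act s x)) =
  (-1) ^+ s * \sum_k (-1) ^+ (k != ord_max) * F (act (tperm k ord_max) x).
Proof.
move=> Fl; rewrite (reindex_inj (@perm_inj _ s)) mulr_sumr; apply: eq_bigr => k _.
have [] := @perm_fix_max m (tperm k ord_max * (s * tperm (s k) ord_max))%g.
  by rewrite !permM tpermR tpermL.
move=> t tE; have sE : (s * tperm (s k) ord_max =
    tperm k ord_max * lift_perm ord_max ord_max t)%g.
  by rewrite -tE mulgA tperm2 mul1g.
have oE : (s k != ord_max) = (s : bool) (+) (k != ord_max) (+) t.
  have /(congr1 (addb s)) := congr1 (@odd_perm _) sE.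
  by rewrite !odd_permM !odd_tperm odd_lift_perm addbb !addFb addbA addbb addFb addbA.
rewrite actM sE -actM Fl oE 2!signr_addb -!mulrA; congr (_ * (_ * _)).
by rewrite signrMK.
Qed.
End Insertion.

Section Graphs.
Variables (N n p : nat).
Implicit Types (g : graph N n p).

Lemma graph_actRM (s t : 'S_n) g :
  graph_actR t (graph_actR s g) = graph_actR (s * t)%g g.
Proof. by congr Graph; apply/ffunP=> i; rewrite !ffunE invMg permM. Qed.
Lemma graph_actCM (s t : 'S_p) g :
  graph_actC t (graph_actC s g) = graph_actC (s * t)%g g.
Proof. by congr Graph; apply/ffunP=> i; rewrite !ffunE invMg permM. Qed.

Lemma graph_actR1 g : graph_actR 1 g = g.
Proof. by apply: graph_eq => // i; rewrite ffunE invg1 perm1. Qed.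
Lemma graph_actC1 g : graph_actC 1 g = g.
Proof. by apply: graph_eq => // i; rewrite ffunE invg1 perm1. Qed.

(** The node [w] loses its edge and becomes the last root; on well-formed graphs
    this undoes [graph_graft], see [cut_graft] and [graft_cut]. *)
Definition cut g w : graph N n.+1 p :=
  Graph [ffun v => if v == w then None else target g v]
        [ffun i => if unlift ord_max i is Some j then root g j else w] (covertex g).

(** [graph_mkcov] at an arbitrary node, so that sums over vertices need no
    dependent index. *)
Definition mkcov_at g v : graph N n p.+1 :=
  Graph (target g) (root g)
    [ffun k => if unlift ord_max k is Some j then covertex g j else v].
End Graphs.

Definition uncov N n p (g : graph N n p.+1) : graph N n p :=
  Graph (target g) (root g) [ffun k => covertex g (lift ord_max k)].

Section GraphLemmas.
Variables (N n p : nat).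

Lemma graft_lift (s : 'S_n) (g : graph N n.+1 p) u :
  graph_graft (graph_actR (lift_perm ord_max ord_max s) g) u =
  graph_actR s (graph_graft g u).
Proof.
by congr Graph; apply/ffunP=> i; rewrite !ffunE /= ?ffunE lift_permV ?lift_perm_id //
  lift_perm_lift.
Qed.

Lemma cut_actR (s : 'S_n) (g : graph N n p) w :
  cut (graph_actR s g) w = graph_actR (lift_perm ord_max ord_max s) (cut g w).
Proof.
congr Graph; apply/ffunP=> i; rewrite !ffunE /= lift_permV.
case: (unliftP ord_max i) => [j ->|->].
  by rewrite lift_perm_lift liftK ffunE.
by rewrite lift_perm_id unlift_none.
Qed.

Lemma uncov_lift (s : 'S_p) (g : graph N n p.+1) :
  uncov (graph_actC (lift_perm ord_max ord_max s) g) = graph_actC s (uncov g).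
Proof.
by congr Graph; apply/ffunP=> i; rewrite !ffunE /= lift_permV lift_perm_lift.
Qed.

Lemma mkcov_actC (s : 'S_p) (g : graph N n p) w :
  mkcov_at (graph_actC s g) w = graph_actC (lift_perm ord_max ord_max s) (mkcov_at g w).
Proof.
congr Graph; apply/ffunP=> i; rewrite !ffunE /= lift_permV.
case: (unliftP ord_max i) => [j ->|->].
  by rewrite lift_perm_lift liftK ffunE.
by rewrite lift_perm_id unlift_none.
Qed.

Lemma uncovK (g : graph N n p) v : uncov (mkcov_at g v) = g.
Proof. by apply: graph_eq => // i; rewrite !ffunE liftK. Qed.

Lemma mkcov_uncov (g : graph N n p.+1) : mkcov_at (uncov g) (covertex g ord_max) = g.
Proof.
apply: graph_eq => // i; rewrite !ffunE.
by case: (unliftP ord_max i) => [j ->|->]; rewrite ?ffunE.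
Qed.

Lemma cut_graft (g : graph N n.+1 p) u :
  target g (root g ord_max) = None -> cut (graph_graft g u) (root g ord_max) = g.
Proof.
move=> tN; apply: graph_eq => //= [v|i]; rewrite !ffunE.
  by case: eqP => [->|//].
by case: (unliftP ord_max i) => [j ->|->]; rewrite ?ffunE.
Qed.

Lemma graft_cut_target (g : graph N n p) v u :
  target (graph_graft (cut g v) u) =1 (fun w => if w == v then Some u else target g w).
Proof. by move=> w /=; rewrite !ffunE unlift_none; case: ifP => // ->. Qed.

Lemma graft_cut (g : graph N n p) v u :
  target g v = Some u -> graph_graft (cut g v) u = g.
Proof.
move=> tv; apply: graph_eq => // [w|i]; first by rewrite graft_cut_target; case: eqP => [->|].
by rewrite !ffunE liftK.
Qed.

Lemma cut_wf (g : graph N n p) w : target g w != None -> wf (cut g w) = wf g.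
Proof.
move=> tw; apply/wfP/wfP=> -[ri rE ci]; split=> //.
- move=> i j ij; apply/(@lift_inj _ ord_max)/ri; by rewrite /= !ffunE !liftK.
- move=> v; case: (v =P w) => [->|/eqP vw].
    rewrite (negPf tw); apply/codomP=> -[i wE].
    have /ri/eqP : root (cut g w) (lift ord_max i) = root (cut g w) ord_max.
      by rewrite /= !ffunE liftK unlift_none.
    by rewrite eq_sym (negPf (neq_lift _ _)).
  move: (rE v); rewrite /= ffunE (negPf vw) => <-; apply/codomP/codomP=> -[i vE].
    by exists (lift ord_max i); rewrite ffunE liftK.
  move: vE; rewrite ffunE; case: (unliftP ord_max i) => [j _ ->|_ vE]; first by exists j.
  by rewrite vE eqxx in vw.
- have rw i : root g i != w.
    by apply: contra tw => /eqP<-; rewrite -rE codom_f.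
  move=> i j; rewrite /= !ffunE; case: (unliftP ord_max i) => [i' ->|->];
    case: (unliftP ord_max j) => [j' ->|->] //.
  + by move=> /ri->.
  + by move/eqP; rewrite (negPf (rw _)).
  + by move/esym/eqP; rewrite (negPf (rw _)).
- move=> v; rewrite /= ffunE; case: (v =P w) => [->|/eqP vw].
    by rewrite eqxx; apply/codomP; exists ord_max; rewrite ffunE unlift_none.
  rewrite -rE; apply/codomP/codomP=> -[i vE]; last first.
    by exists (lift ord_max i); rewrite ffunE liftK.
  move: vE; rewrite ffunE; case: (unliftP ord_max i) => [j _ ->|_ vE]; first by exists j.
  by rewrite vE eqxx in vw.
Qed.

Lemma graph_graft_wf (g : graph N n.+1 p) u : wf g -> wf (graph_graft g u).
Proof. by move=> wg; apply: (graft_wf (LForest wg)). Qed.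

Lemma mkcov_at_wf (g : graph N n p) v :
  v \notin codom (covertex g) -> wf g -> wf (mkcov_at g v).
Proof. by move=> vN wg; apply: (@mkcov_wf _ _ _ (LForest wg) (exist _ v vN)). Qed.

Lemma uncov_wf (g : graph N n p.+1) : wf g -> wf (uncov g).
Proof.
case/wfP=> ri rE ci; apply/wfP; split=> // i j.
by rewrite /= !ffunE => /ci /lift_inj.
Qed.

Lemma covertex_max_notin (g : graph N n p.+1) :
  wf g -> covertex g ord_max \notin codom (covertex (uncov g)).
Proof.
case/wfP=> _ _ ci; apply/codomP=> -[i]; rewrite /= ffunE => /ci /eqP.
by rewrite (negPf (neq_lift _ _)).
Qed.

Lemma actR_wfE s (g : graph N n p) : wf (graph_actR s g) = wf g.
Proof.
have w (t : 'S_n) (h : graph N n p) : wf h -> wf (graph_actR t h).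
  by move=> wh; apply: (actR_wf t (LForest wh)).
apply/idP/idP; last exact: w.
by move/(w s^-1%g); rewrite graph_actRM mulgV graph_actR1.
Qed.
Lemma actC_wfE s (g : graph N n p) : wf (graph_actC s g) = wf g.
Proof.
have w (t : 'S_p) (h : graph N n p) : wf h -> wf (graph_actC t h).
  by move=> wh; apply: (actC_wf t (LForest wh)).
apply/idP/idP; last exact: w.
by move/(w s^-1%g); rewrite graph_actCM mulgV graph_actC1.
Qed.

End GraphLemmas.

Section Functions.
Variables (R : realType) (N : nat).

(** * Alternating functions on labelled graphs *)

Definition alternating n p (A : graph N n p -> R) :=
  (forall s g, A (graph_actR s g) = (-1) ^+ s * A g) /\
  (forall s g, A (graph_actC s g) = (-1) ^+ s * A g).

Definition loop_free n p (g : graph N n p) := wf g && ~~ has_loop g.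

Lemma sign_lift m (s : 'S_m) :
  (-1) ^+ (lift_perm ord_max ord_max s) = (-1) ^+ s :> R.
Proof. by rewrite odd_lift_perm addbb. Qed.

Lemma sign_tperm m (k l : 'I_m) : (-1) ^+ (tperm k l) = (-1) ^+ (k != l) :> R.
Proof. by rewrite odd_tperm. Qed.

(** The horizontal differential on coefficient functions, see [dH_push]: the
    graphs that yield [g] by grafting their last root are the [cut g w]. *)
Definition cut_sum n p (A : graph N n.+1 p -> R) (g : graph N n p) : R :=
  \sum_(w | target g w != None) A (cut g w).

(** The last root is handled here; [uproot] reaches the root of any number by
    bringing it into last position, with the corresponding sign. *)
Definition graft_root n p (v : 'I_N) (A : graph N n p -> R) (g : graph N n.+1 p) : R :=
  if root g ord_max == v then \sum_(u | u != v) A (graph_graft g u) else 0.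

Definition uproot n p (v : 'I_N) (A : graph N n p -> R) (g : graph N n.+1 p) : R :=
  N.-1%:R^-1 *
  \sum_k (-1) ^+ (k != ord_max) * graft_root v A (graph_actR (tperm k ord_max) g).

Section Alternating.
Variables n p : nat.

Lemma cut_sum_alt (A : graph N n.+1 p -> R) : alternating A -> alternating (cut_sum A).
Proof.
case=> aR aC; split=> s g; rewrite /cut_sum mulr_sumr; apply: eq_bigr => w _.
  by rewrite cut_actR aR sign_lift.
by rewrite -aC.
Qed.

(** Cutting two edges in either order gives the same graph up to the exchange
    of the last two root numbers; this is why d_H squares to zero. *)
Lemma cut_cut (g : graph N n p) w w' :
  cut (cut g w) w' =
  graph_actR (tperm (lift ord_max ord_max) ord_max) (cut (cut g w') w).
Proof.
apply: graph_eq => // [v|i]; first by rewrite /= !ffunE; case: (v == w); case: (v == w').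
rewrite /= !ffunE tpermV; case: (unliftP ord_max i) => [j ->|->].
  rewrite !ffunE; case: (unliftP ord_max j) => [k ->|->].
    by rewrite tpermD ?liftK ?ffunE ?liftK // ?(inj_eq lift_inj) neq_lift.
  by rewrite tpermL unlift_none.
by rewrite tpermR liftK ffunE unlift_none.
Qed.

Lemma cut_sum_cut_sum (A : graph N n.+2 p -> R) g :
  alternating A -> cut_sum (cut_sum A) g = 0.
Proof.
case=> aR _; apply/eqP; rewrite -eqNr; apply/eqP; rewrite /cut_sum -sumrN.
rewrite [RHS](exchange_big_dep (fun w => target g w != None)) /=; last first.
  by move=> w w' _; rewrite ffunE; case: (w' == w).
apply: eq_bigr => w tw; rewrite -sumrN; apply: eq_big => [w'|w' _].
  by rewrite !ffunE [w' == w]eq_sym; case: (w == w'); rewrite ?andbF ?tw ?andbT.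
by rewrite [in RHS]cut_cut aR sign_tperm eq_sym neq_lift mulN1r.
Qed.

Lemma uproot_alt v (A : graph N n p -> R) : alternating A -> alternating (uproot v A).
Proof.
case=> aR aC; split=> s g; rewrite /uproot mulrCA; congr (_ * _); last first.
  rewrite mulr_sumr; apply: eq_bigr => k _; rewrite mulrCA; congr (_ * _).
  rewrite /graft_root /=; case: eqP => _; last by rewrite mulr0.
  by rewrite mulr_sumr; apply: eq_bigr => u _; rewrite -aC.
apply: (insert_act (@graph_actRM N n.+1 p)) => t h.
rewrite /graft_root /= ffunE lift_permV lift_perm_id; case: eqP => _; last by rewrite mulr0.
by rewrite mulr_sumr; apply: eq_bigr => u _; rewrite graft_lift aR.
Qed.
End Alternating.

(** * The horizontal homotopy at one node *)

Section Homotopy.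
Variables n p : nat.
Hypothesis N1 : (1 < N)%N.

Lemma sum_other_nodes (v : 'I_N) :
  N.-1%:R != 0 :> R /\ forall x : R, \sum_(u | u != v) x = N.-1%:R * x.
Proof.
split; first by rewrite pnatr_eq0 -lt0n -ltnS prednK ?(ltnW N1).
by move=> x; rewrite mulr_natl sumr_const cardC1 card_ord.
Qed.

(** If [v] has an edge, it is a root of [cut g w] only for [w = v], and then
    the last one; so a single term of the differential survives and averages
    over the new target of [v]. *)
Lemma cut_uproot_nonroot v (A : graph N n p -> R) g : wf g -> target g v != None ->
  cut_sum (uproot v A) g =
  N.-1%:R^-1 * \sum_(u | u != v) A (graph_graft (cut g v) u).
Proof.
case/wfP=> _ rE _ tv; rewrite /cut_sum (bigD1 v) //=.
rewrite [X in _ + X]big1 ?addr0 => [|w /andP[tw wv]].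
  rewrite /uproot; congr (_ * _); rewrite (bigD1 ord_max) //= big1 ?addr0 => [|k km].
    by rewrite eqxx mul1r /graft_root tperm1 graph_actR1 ffunE unlift_none eqxx.
  rewrite /graft_root ffunE tpermV tpermR.
  case: (unliftP ord_max k) km => [j -> _|->]; last by rewrite eqxx.
  rewrite ffunE liftK; case: (_ =P v) => [rv|]; last by rewrite mulr0.
  by rewrite -rE -rv codom_f in tv.
rewrite /uproot big1 ?mulr0 // => k _.
rewrite /graft_root ffunE tpermV tpermR ffunE; case: (unlift ord_max k) => [j|].
  case: (_ =P v) => [rv|]; last by rewrite mulr0.
  by rewrite -rE -rv codom_f in tv.
by rewrite (negPf wv) mulr0.
Qed.

(** The moves at [v = root g k] and at another node [w] commute, except that
    they exchange the numbers [k] and [ord_max]: the Koszul sign by which the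
    mixed terms of d h and h d cancel. *)
Lemma cut_graft_swap (g : graph N n.+1 p) (k : 'I_n.+1) w u :
  root g k != w ->
  graph_graft (graph_actR (tperm (lift ord_max k) ord_max) (cut g w)) u =
  graph_actR (tperm k ord_max) (cut (graph_graft (graph_actR (tperm k ord_max) g) u) w).
Proof.
move=> rw; apply: graph_eq => //= [x|i].
  rewrite !ffunE !tpermV !tpermR liftK.
  by case: (x =P root g k) => [->|//]; rewrite (negPf rw).
rewrite !ffunE !tpermV.
case: (i =P k) => [->|/eqP ik].
  by rewrite !tpermL !unlift_none.
rewrite tpermD ?neq_lift // 1?eq_sym ?(inj_eq lift_inj) // liftK.
case: (tpermP k ord_max i) ik => [->|iE kE|/eqP ik /eqP im _]; first by rewrite eqxx.
  case: (unliftP ord_max k) kE => [j kE _|->]; last by rewrite iE eqxx.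
  by rewrite !ffunE -kE tpermL iE.
case: (unliftP ord_max i) im => [j iE _|->]; last by rewrite eqxx.
by rewrite !ffunE -iE tpermD 1?eq_sym // {1}iE eq_sym neq_lift.
Qed.

(** The terms where the edge cut is not the one just attached to [v] cancel in
    pairs by [cut_graft_swap].  In the remaining ones [v] is attached to one of
    N - 1 nodes and cut again, which gives N - 1 times [A g]. *)
Lemma uproot_homotopy_root k (A : graph N n.+1 p -> R) g : wf g -> alternating A ->
  cut_sum (uproot (root g k) A) g + uproot (root g k) (cut_sum A) g = A g.
Proof.
set v := root g k => /wfP[ri rE _] [aR _].
have [N0 sumc] := sum_other_nodes v.
have tv : target g v = None by apply/eqP; rewrite -rE codom_f.
(* Separating the cut at [v] from the cuts at the nodes [w] of [g] with an edge. *)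
have -> : uproot v (cut_sum A) g = A g + N.-1%:R^-1 * \sum_(w | target g w != None)
   (-1) ^+ (k != ord_max) *
   \sum_(u | u != v) A (cut (graph_graft (graph_actR (tperm k ord_max) g) u) w).
  rewrite /uproot (bigD1 k) //= [X in _ + X]big1 ?addr0 => [|j jk]; last first.
    rewrite /graft_root ffunE tpermV tpermR.
    case: (_ =P v) => [/ri jE|]; last by rewrite mulr0.
    by rewrite jE eqxx in jk.
  rewrite {1}/graft_root ffunE tpermV tpermR eqxx.
  have sw u : cut_sum A (graph_graft (graph_actR (tperm k ord_max) g) u) =
     (-1) ^+ (k != ord_max) * A g + \sum_(w | target g w != None)
       A (cut (graph_graft (graph_actR (tperm k ord_max) g) u) w).
    have rv : root (graph_actR (tperm k ord_max) g) ord_max = v.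
      by rewrite ffunE tpermV tpermR.
    rewrite /cut_sum (bigD1 v) /=; last by rewrite ffunE rv eqxx.
    rewrite -[X in cut _ X]rv cut_graft ?rv // aR sign_tperm; congr (_ + _).
    apply: eq_bigl => w; rewrite ffunE.
    by case: (w =P v) => [->|_]; rewrite ?tv ?andbF //= andbT.
  under [in LHS]eq_bigr do rewrite sw.
  rewrite big_split /= sumc mulrDr mulrDr mulrCA; congr (_ + _).
    by rewrite mulKf // signrMK.
  by rewrite exchange_big -mulr_sumr.
(* In [cut g w] the root [v] is no longer last: its number is [lift ord_max k]. *)
have -> : cut_sum (uproot v A) g = - (N.-1%:R^-1 * \sum_(w | target g w != None)
   (-1) ^+ (k != ord_max) *
   \sum_(u | u != v) A (cut (graph_graft (graph_actR (tperm k ord_max) g) u) w)).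
  rewrite /cut_sum /uproot -[LHS]mulr_sumr -mulrN -sumrN; congr (_ * _).
  apply: eq_bigr => w tw.
  have vw : v != w by apply: contra tw => /eqP<-; rewrite tv.
  rewrite (bigD1 (lift ord_max k)) //= [X in _ + X]big1 ?addr0 => [|j jk]; last first.
    rewrite /graft_root ffunE tpermV tpermR ffunE.
    case: (unliftP ord_max j) jk => [i ->|_ _].
      rewrite (inj_eq lift_inj); case: (_ =P v) => [/ri->|]; last by rewrite mulr0.
      by rewrite eqxx.
    by rewrite [w == v]eq_sym (negPf vw) mulr0.
  rewrite /graft_root ffunE tpermV tpermR ffunE liftK eqxx eq_sym neq_lift mulN1r.
  congr (- _); rewrite mulr_sumr; apply: eq_bigr => u _.
  by rewrite cut_graft_swap // aR sign_tperm.
by rewrite addrCA addNr addr0.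
Qed.

End Homotopy.

Lemma alternatingB n p (A B : graph N n p -> R) :
  alternating A -> alternating B -> alternating (fun g => A g - B g).
Proof.
by case=> aR aC [bR bC]; split=> s g; rewrite ?(aR, aC, bR, bC) mulrBr.
Qed.

Lemma alternatingD n p (A B : graph N n p -> R) :
  alternating A -> alternating B -> alternating (fun g => A g + B g).
Proof.
by case=> aR aC [bR bC]; split=> s g; rewrite ?(aR, aC, bR, bC) mulrDr.
Qed.

(** * Horizontal exactness for functions *)

Section Clearing.
Variables n p : nat.
Hypothesis N1 : (1 < N)%N.

Lemma loop_free_graft m (g : graph N m.+1 p) u :
  loop_free g -> u != root g ord_max -> loop_free (graph_graft g u).
Proof.
case/andP=> wg lg ur; rewrite /loop_free graph_graft_wf //=.
apply: contra lg => /existsP[w /=]; rewrite ffunE.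
case: (w =P root g ord_max) => [->|_ tw]; last by apply/existsP; exists w.
by case/eqP=> uE; rewrite uE eqxx in ur.
Qed.

Lemma loop_free_cut m (g : graph N m p) w :
  target g w != None -> loop_free g -> loop_free (cut g w).
Proof.
move=> tw /andP[wg lg]; rewrite /loop_free cut_wf // wg /=.
apply: contra lg => /existsP[x]; rewrite ffunE; case: (x == w) => // tx.
by apply/existsP; exists x.
Qed.

Lemma loop_free_actR m s (g : graph N m p) : loop_free (graph_actR s g) = loop_free g.
Proof. by rewrite /loop_free actR_wfE. Qed.

(** Induction on the list of treated nodes.  The difference C is again an
    alternating cycle; replacing it by C - d (uproot v C) kills it where [v] is
    a root.  Where [v] is not a root this subtracts an average of values of C
    at graphs with the same roots, so the zeros already obtained remain. *)
Lemma clear_roots (s : seq 'I_N) (A : graph N n.+1 p -> R) :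
  alternating A -> (forall g, loop_free g -> cut_sum A g = 0) ->
  exists2 B : graph N n.+2 p -> R, alternating B &
    forall g i, loop_free g -> root g i \in s -> A g = cut_sum B g.
Proof.
move=> altA clA.
suff [B [altB _ _ BE]] : exists B : graph N n.+2 p -> R,
    let C g := A g - cut_sum B g in
    [/\ alternating B, alternating C, forall g, loop_free g -> cut_sum C g = 0 &
      forall g i, loop_free g -> root g i \in s -> C g = 0].
  by exists B => // g i gg gi; apply/eqP; rewrite -subr_eq0; apply/eqP/(BE g i).
elim: s => [|v s [B /= [altB altC clC CE]]].
  exists (fun=> 0) => /=; split=> //; first by split=> *; rewrite mulr0.
    apply: alternatingB => //; apply: (@cut_sum_alt n.+1).
    by split=> *; rewrite mulr0.
  move=> g gg; rewrite /cut_sum -[RHS](clA g gg); apply: eq_bigr => w _.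
  by rewrite [X in _ - X]big1 ?subr0.
set C := (fun g => A g - cut_sum B g) in altC clC.
have {}CE g i : loop_free g -> root g i \in s -> C g = 0 by apply: CE.
have altU : alternating (uproot v C) by apply: uproot_alt.
exists (fun g => B g + uproot v C g) => /=.
have E g : A g - cut_sum (fun g => B g + uproot v C g) g = C g - cut_sum (uproot v C) g.
  by rewrite /C /cut_sum big_split opprD addrA.
(* As C is a cycle, d h + h d reduces to d h on C. *)
have root0 g : loop_free g -> uproot v (cut_sum C) g = 0.
  move=> gg; rewrite /uproot big1 ?mulr0 // => k _.
  rewrite /graft_root; case: (_ =P v) => [rv|]; last by rewrite mulr0.
  by rewrite big1 ?mulr0 // => u uv; rewrite clC // loop_free_graft ?loop_free_actR ?rv.
split.
- exact: alternatingD.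
- have [] := alternatingB altC (cut_sum_alt altU).
  by split=> *; rewrite !E.
- move=> g gg; rewrite /cut_sum; under eq_bigr do rewrite E.
  rewrite big_split sumrN /= -/(cut_sum C g) clC //.
  by rewrite -/(cut_sum (cut_sum (uproot v C)) g) cut_sum_cut_sum // subr0.
- move=> g i gg; have wg : wf g by case/andP: gg.
  have /wfP[_ rE _] := wg.
  rewrite E inE; case: (boolP (v \in codom (root g))) => [/codomP[k vE] _|].
    have := uproot_homotopy_root N1 k wg altC.
    by rewrite -vE root0 // addr0 => ->; rewrite subrr.
  rewrite rE => tv.
  case: eqP => [riv|_ /= ris].
    by case/negP: tv; rewrite -riv -rE codom_f.
  rewrite (CE g i) // sub0r cut_uproot_nonroot // big1 ?mulr0 ?oppr0 // => u uv.
  apply: (CE _ i); last by rewrite /= !ffunE liftK.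
  by apply: loop_free_graft; rewrite ?loop_free_cut // ffunE unlift_none.
Qed.

Lemma cut_sum_exact (A : graph N n.+1 p -> R) :
  alternating A -> (forall g, loop_free g -> cut_sum A g = 0) ->
  exists2 B : graph N n.+2 p -> R, alternating B &
    forall g, loop_free g -> A g = cut_sum B g.
Proof.
move=> altA /(clear_roots (enum 'I_N) altA)[B altB BE]; exists B => // g gg.
by apply: (BE g ord_max); rewrite ?mem_enum.
Qed.
End Clearing.

(** * The vertical homotopy *)

Section Vertical.
Variable n : nat.

(** The vertical differential on coefficient functions, up to the factor p + 1
    of [dV_push]: the sum represents the alternation over all covertex numbers
    by one permutation in each coset. *)
Definition uncov_sum p (A : graph N n p -> R) (g : graph N n p.+1) : R :=
  \sum_k (-1) ^+ (k != ord_max) * A (uncov (graph_actC (tperm k ord_max) g)).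

Definition mkcov_sum p (A : graph N n p.+1 -> R) (g : graph N n p) : R :=
  \sum_(v | v \notin codom (covertex g)) A (mkcov_at g v).

Definition move_cov p (g : graph N n p) k v : graph N n p :=
  Graph (target g) (root g) [ffun i => if i == k then v else covertex g i].

Lemma uncov_sum_alt p (A : graph N n p -> R) :
  alternating A -> alternating (uncov_sum A).
Proof.
case=> aR aC; split=> s g; rewrite /uncov_sum; last first.
  apply: (insert_act (@graph_actCM N n p.+1) (F := fun g => A (uncov g))) => t h.
  by rewrite uncov_lift aC.
rewrite mulr_sumr; apply: eq_bigr => k _; rewrite mulrCA; congr (_ * _).
by rewrite -aR.
Qed.

Lemma codom_actC p s (g : graph N n p) :
  codom (covertex (graph_actC s g)) =i codom (covertex g).
Proof.
move=> v; apply/codomP/codomP=> -[i ->]; first by rewrite ffunE; eexists.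
by exists (s i); rewrite ffunE permK.
Qed.

Lemma mkcov_sum_alt p (A : graph N n p.+1 -> R) :
  alternating A -> alternating (mkcov_sum A).
Proof.
case=> aR aC; split=> s g; rewrite /mkcov_sum mulr_sumr.
  by apply: eq_bigr => v _; rewrite -aR.
rewrite (eq_bigl _ _ (fun v => congr1 negb (codom_actC s g v))).
by apply: eq_bigr => v _; rewrite mkcov_actC aC sign_lift.
Qed.

(** If [v] becomes a covertex and then the covertex [j] becomes a vertex, the
    covertex [j] has moved to [v]; these terms occur in both orders of the two
    operators, with opposite signs. *)
Lemma uncov_swap p (g : graph N n p) v j :
  uncov (graph_actC (tperm (lift ord_max j) ord_max) (mkcov_at g v)) = move_cov g j v.
Proof.
apply: graph_eq => // i; rewrite !ffunE tpermV; case: (i =P j) => [->|/eqP ij].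
  by rewrite tpermL unlift_none.
by rewrite tpermD ?neq_lift ?(inj_eq lift_inj) 1?eq_sym // liftK.
Qed.

Lemma mkcov_uncov_sum p (A : graph N n p -> R) g : wf g ->
  mkcov_sum (uncov_sum A) g = (N - p)%:R * A g
    - \sum_(v | v \notin codom (covertex g)) \sum_k A (move_cov g k v).
Proof.
case/wfP=> _ _ ci; rewrite /mkcov_sum -sumrN.
have -> : (N - p)%:R * A g = \sum_(v | v \notin codom (covertex g)) A g.
  rewrite sumr_const mulr_natl; congr (_ *+ _).
  rewrite -[N in LHS]card_ord -(cardC (mem (codom (covertex g)))).
  by rewrite card_codom // card_ord addKn.
rewrite -big_split; apply: eq_bigr => v vN /=.
rewrite /uncov_sum (bigD1_ord ord_max) //= eqxx mul1r tperm1 graph_actC1 uncovK.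
congr (_ + _).
rewrite -sumrN; apply: eq_bigr => j _.
by rewrite uncov_swap eq_sym neq_lift mulN1r.
Qed.

Lemma swap_mkcov p (g : graph N n p.+1) k v :
  mkcov_at (uncov (graph_actC (tperm k ord_max) g)) v =
  graph_actC (tperm k ord_max) (move_cov g k v).
Proof.
apply: graph_eq => // i; rewrite !ffunE tpermV.
case: (unliftP ord_max i) => [j iE|->]; last by rewrite tpermR eqxx.
rewrite !ffunE tpermV -iE; case: eqP => [tk|//].
have : i = ord_max by apply: (@perm_inj _ (tperm k ord_max)); rewrite tk tpermR.
by rewrite iE => /eqP; rewrite eq_sym (negPf (neq_lift _ _)).
Qed.

(** Once the covertex [k] has become a vertex it may itself be made a covertex
    again, which returns [g]; this accounts for p + 1 times [A g]. *)
Lemma uncov_mkcov_sum p (A : graph N n p.+1 -> R) g : wf g -> alternating A ->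
  uncov_sum (mkcov_sum A) g = p.+1%:R * A g
    + \sum_(v | v \notin codom (covertex g)) \sum_k A (move_cov g k v).
Proof.
move=> wg [aR aC]; have /wfP[_ _ ci] := wg.
rewrite [X in _ + X]exchange_big /=.
have -> : p.+1%:R * A g = \sum_(k < p.+1) A g by rewrite sumr_const card_ord mulr_natl.
rewrite -big_split; apply: eq_bigr => k _ /=.
have cE : covertex (graph_actC (tperm k ord_max) g) ord_max = covertex g k.
  by rewrite ffunE tpermV tpermR.
have kN := covertex_max_notin (etrans (actC_wfE (tperm k ord_max) g) wg).
rewrite cE in kN; rewrite /mkcov_sum (bigD1 (covertex g k)) //= mulrDr; congr (_ + _).
  by rewrite -[X in mkcov_at _ X]cE mkcov_uncov aC sign_tperm signrMK.
rewrite mulr_sumr; apply: eq_big => [v|v _]; last first.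
  by rewrite swap_mkcov aC sign_tperm signrMK.
apply/idP/idP=> [/andP[vN vk]|vN].
  apply: contra vN => /codomP[i vE]; apply/codomP.
  have ik : i != k by apply: contra vk => /eqP<-; rewrite vE.
  case: (unliftP ord_max (tperm k ord_max i)) => [j iE|iE].
    by exists j; rewrite !ffunE -iE tpermV tpermK.
  by case/eqP: ik; apply: (@perm_inj _ (tperm k ord_max)); rewrite iE tpermL.
rewrite -(codom_actC (tperm k ord_max)) in vN; apply/andP; split.
  by apply: contra vN => /codomP[i ->]; rewrite ffunE codom_f.
by apply: contra vN => /eqP->; rewrite -cE codom_f.
Qed.

Lemma vertical_homotopy0 (A : graph N n 0 -> R) g : wf g ->
  mkcov_sum (uncov_sum A) g = N%:R * A g.
Proof.
move=> wg; rewrite mkcov_uncov_sum // subn0 big1 ?subr0 // => v _.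
by rewrite big_ord0.
Qed.

Lemma vertical_homotopy p (A : graph N n p.+1 -> R) g : wf g -> alternating A ->
  mkcov_sum (uncov_sum A) g + uncov_sum (mkcov_sum A) g = N%:R * A g.
Proof.
move=> wg altA; rewrite mkcov_uncov_sum // uncov_mkcov_sum // addrACA addNr addr0.
rewrite -mulrDl -natrD subnK //.
have /wfP[_ _ ci] := wg.
by rewrite -[N]card_ord -[p.+1]card_ord -(card_codom ci) max_card.
Qed.
End Vertical.
End Functions.

(** * Forms as functions on labelled graphs *)

Section Transfer.
Variables (R : realType) (N : nat).

(** Extended by 0 to ill-formed graphs, so that sums can be reindexed along
    moves of graphs without carrying proofs of well-formedness. *)
Definition graph_delta n p (g : graph N n p) : span R N n p :=
  if insub g is Some h then delta (fclass h) else 0.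

Definition push n p (A : graph N n p -> R) : span R N n p :=
  \sum_g A g *: graph_delta g.

Definition iso_invariant n p (A : graph N n p -> R) :=
  forall s g h, wf g -> wf h -> isomap s g h -> A g = A h.

Definition iso_class n p (g : lforest N n p) : {set lforest N n p} :=
  [set h | fclass h == fclass g].

(** The invariant section of [push], see [spreadK]; invariance allows
    the vanishing of [push A] to be read off on each labelled graph. *)
Definition spread n p (a : span R N n p) (g : graph N n p) : R :=
  if insub g is Some h then a (fclass h) / #|iso_class h|%:R else 0.

Section Push.
Variables n p : nat.
Implicit Types A : graph N n p -> R.

Lemma insub_lgraph (g : lforest N n p) : insub (lgraph g) = Some g.
Proof. exact: valK. Qed.

Lemma graph_deltaE (g : lforest N n p) : graph_delta g = delta (fclass g).
Proof.
rewrite /graph_delta insubT ?lgraph_wf // => wg.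
by congr (delta (fclass _)); apply: val_inj.
Qed.

Lemma graph_delta_nwf (g : graph N n p) : ~~ wf g -> graph_delta g = 0.
Proof. by move=> wg; rewrite /graph_delta insubF //; apply: negbTE. Qed.

Lemma push_wf A : push A = \sum_(g | wf g) A g *: graph_delta g.
Proof.
rewrite /push (bigID (@wf N n p)) /= [X in _ + X]big1 ?addr0 // => g wg.
by rewrite graph_delta_nwf ?scaler0.
Qed.

Lemma push_lforest A : push A = \sum_(g : lforest N n p) A g *: delta (fclass g).
Proof.
rewrite push_wf (reindex_omap (@lgraph N _ p)
  (insub : _ -> option (lforest N _ p))) /=; last first.
  by move=> g wg; rewrite insubT.
by apply: eq_big => [g|g _]; rewrite ?graph_deltaE // lgraph_wf insub_lgraph eqxx.
Qed.

Lemma push_coef A (g : lforest N n p) :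
  push A (fclass g) = \sum_(h in iso_class g) A h.
Proof.
rewrite push_lforest sum_ffunE [RHS]big_mkcond; apply: eq_bigr => h _.
rewrite inE delta.unlock !ffunE eq_sym; case: eqP => _; last by rewrite scaler0.
by rewrite /GRing.scale /= mulr1.
Qed.

Lemma eq_push A A' : (forall g, wf g -> A g = A' g) -> push A = push A'.
Proof. by move=> AA; rewrite !push_wf; apply: eq_bigr => g /AA->. Qed.

Lemma pushB A A' : push (fun g => A g - A' g) = push A - push A'.
Proof. by rewrite /push -sumrB; apply: eq_bigr => g _; rewrite scalerBl. Qed.

Lemma pushZ c A : push (fun g => c * A g) = c *: push A.
Proof. by rewrite /push scaler_sumr; apply: eq_bigr => g _; rewrite scalerA. Qed.

Lemma push_sum (I : finType) (F : I -> graph N n p -> R) :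
  push (fun g => \sum_i F i g) = \sum_i push (F i).
Proof. by rewrite /push exchange_big; apply: eq_bigr => g _; rewrite scaler_suml. Qed.

Lemma loop_spanP (a : span R N n p) :
  reflect (forall x, ~~ forest_has_loop x -> a x = 0) (a \in loop_span R N n p).
Proof.
apply: (iffP idP) => [/coord_span-> x xl|a0].
  rewrite sum_ffunE big1 // => i _.
  pose X : seq (span R N n p) := [seq delta x | x in @forest_has_loop N n p].
  have /imageP[y yl ->] : X`_i \in X by apply: mem_nth; rewrite size_image.
  rewrite delta.unlock !ffunE; case: eqP => [xy|_]; last by rewrite scaler0.
  by case/negP: xl; rewrite xy; apply: yl.
rewrite [a]span_sum linext.unlock memv_suml // => x _.
case: (boolP (forest_has_loop x)) => [xl|/a0->]; last by rewrite scale0r mem0v.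
by rewrite memvZ // delta_loop.
Qed.

Lemma iso_inv_coef A (g : lforest N n p) :
  iso_invariant A -> push A (fclass g) = #|iso_class g|%:R * A g.
Proof.
move=> invA; rewrite push_coef (eq_bigr (fun=> A g)); last first.
  by move=> h; rewrite inE => /isoP[s]; apply: invA; apply: lgraph_wf.
by rewrite sumr_const mulr_natl.
Qed.

Lemma card_iso_class_neq0 (g : lforest N n p) : #|iso_class g|%:R != 0 :> R.
Proof.
rewrite pnatr_eq0 -lt0n; apply/card_gt0P; exists g.
by rewrite inE.
Qed.

Lemma push_loop A : (forall g, loop_free g -> A g = 0) -> push A \in loop_span R N n p.
Proof.
move=> A0; apply/loop_spanP; elim/forest_ind=> g; rewrite has_loop_pi => gl.
rewrite push_coef big1 // => h; rewrite inE => hg; apply: A0.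
by rewrite /loop_free lgraph_wf -has_loop_pi (eqP hg) has_loop_pi.
Qed.

Lemma push_loop_inv A g : iso_invariant A -> push A \in loop_span R N n p ->
  loop_free g -> A g = 0.
Proof.
move=> invA /loop_spanP A0 /andP[wg lg].
have := A0 (fclass (LForest wg)); rewrite has_loop_pi => /(_ lg) /eqP.
by rewrite iso_inv_coef // mulf_eq0 (negPf (card_iso_class_neq0 _)) => /eqP.
Qed.

Lemma push_inj A g : iso_invariant A -> push A = 0 -> wf g -> A g = 0.
Proof.
move=> invA A0 wg; have /eqP := iso_inv_coef (LForest wg) invA.
by rewrite A0 ffunE eq_sym mulf_eq0 (negPf (card_iso_class_neq0 _)) => /eqP.
Qed.

Lemma spread_iso (a : span R N n p) : iso_invariant (spread a).
Proof.
move=> s g h wg wh sgh; rewrite /spread !insubT.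
have ghE : fclass (Sub g wg : lforest N n p) = fclass (Sub h wh : lforest N n p).
  by apply/eqP/isoP; exists s.
by rewrite /iso_class !ghE.
Qed.

Lemma spreadK (a : span R N n p) : push (spread a) = a.
Proof.
apply/ffunP; elim/forest_ind=> g; rewrite iso_inv_coef; last exact: spread_iso.
rewrite /spread insubT ?lgraph_wf // => wg.
have -> : Sub (lgraph g) wg = g by apply: val_inj.
by rewrite mulrC divfK // card_iso_class_neq0.
Qed.

Lemma spanR_push s A : spanR s (push A) = push (fun g => A (graph_actR s^-1 g)).
Proof.
rewrite push_wf [RHS]push_wf linear_sum.
rewrite [RHS](reindex_onto (graph_actR s) (graph_actR s^-1)) /=; last first.
  by move=> g _; rewrite graph_actRM mulVg graph_actR1.
have K g : graph_actR s^-1 (graph_actR s g) = g :> graph N n p.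
  by rewrite graph_actRM mulgV graph_actR1.
apply: eq_big => [g|g wg]; first by rewrite K eqxx andbT actR_wfE.
rewrite K linearZ; congr (_ *: _).
by rewrite -[g]/(val (LForest wg)) graph_deltaE [LHS]spanR_delta actR_pi -graph_deltaE.
Qed.

Lemma spanC_push s A : spanC s (push A) = push (fun g => A (graph_actC s^-1 g)).
Proof.
rewrite push_wf [RHS]push_wf linear_sum.
rewrite [RHS](reindex_onto (graph_actC s) (graph_actC s^-1)) /=; last first.
  by move=> g _; rewrite graph_actCM mulVg graph_actC1.
have K g : graph_actC s^-1 (graph_actC s g) = g :> graph N n p.
  by rewrite graph_actCM mulgV graph_actC1.
apply: eq_big => [g|g wg]; first by rewrite K eqxx andbT actC_wfE.
rewrite K linearZ; congr (_ *: _).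
by rewrite -[g]/(val (LForest wg)) graph_deltaE [LHS]spanC_delta actC_pi -graph_deltaE.
Qed.

Lemma push_Omega A : alternating A -> push A \in Omega R N n p.
Proof.
case=> aR aC; apply/OmegaP; split=> s; rewrite ?spanR_push ?spanC_push -pushZ.
  by apply: eq_push => g _; rewrite aR odd_permV.
by apply: eq_push => g _; rewrite aC odd_permV.
Qed.

Lemma isomap_actR s t (g h : graph N n p) :
  isomap s g h -> isomap s (graph_actR t g) (graph_actR t h).
Proof. by case/isomapP=> tE rE cE; apply/isomapP; split=> //= i; rewrite !ffunE. Qed.

Lemma isomap_actC s t (g h : graph N n p) :
  isomap s g h -> isomap s (graph_actC t g) (graph_actC t h).
Proof. by case/isomapP=> tE rE cE; apply/isomapP; split=> //= i; rewrite !ffunE. Qed.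

(** The defect of alternation is an invariant function, and its image under
    the injective [push] is the defect of alternation of [a]. *)
Lemma spread_alt (a : span R N n p) : a \in Omega R N n p -> alternating (spread a).
Proof.
have nwf g : ~~ wf g -> spread a g = 0.
  by move=> wg; rewrite /spread insubF //; apply: negbTE.
case/OmegaP=> aR aC; split=> s g.
  case: (boolP (wf g)) => [wg|wg]; last by rewrite !nwf ?mulr0 ?actR_wfE.
  apply/eqP; rewrite -subr_eq0; apply/eqP.
  apply: (@push_inj (fun g => spread a (graph_actR s g) - (-1) ^+ s * spread a g)) => //.
    move=> t h k wh wk hk; congr (_ - _ * _); last exact: spread_iso hk.
    by apply: (@spread_iso a t); rewrite ?actR_wfE // isomap_actR.
  rewrite pushB pushZ spreadK -[s in graph_actR s]invgK -spanR_push spreadK aR.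
  by rewrite odd_permV subrr.
case: (boolP (wf g)) => [wg|wg]; last by rewrite !nwf ?mulr0 ?actC_wfE.
apply/eqP; rewrite -subr_eq0; apply/eqP.
apply: (@push_inj (fun g => spread a (graph_actC s g) - (-1) ^+ s * spread a g)) => //.
  move=> t h k wh wk hk; congr (_ - _ * _); last exact: spread_iso hk.
  by apply: (@spread_iso a t); rewrite ?actC_wfE // isomap_actC.
rewrite pushB pushZ spreadK -[s in graph_actC s]invgK -spanC_push spreadK aC.
by rewrite odd_permV subrr.
Qed.
End Push.

Section HorizontalTransfer.
Variables n p : nat.

(** Both sides are sums over pairs: a graph with a new target [u] for its last
    root on the left, a grafted graph with a non-root [w] on the right. *)
Lemma dH_push (A : graph N n.+1 p -> R) : dH (push A) = push (cut_sum A).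
Proof.
rewrite push_lforest linear_sum.
have -> : \sum_(g : lforest N n.+1 p) dH (A g *: delta (fclass g)) =
    \sum_(g : graph N n.+1 p | wf g) \sum_u A g *: graph_delta (graph_graft g u).
  rewrite [RHS](reindex_omap (@lgraph N _ p)
    (insub : _ -> option (lforest N _ p))) /=; last first.
    by move=> g wg; rewrite insubT.
  apply: eq_big => [g|g _]; first by rewrite lgraph_wf insub_lgraph eqxx.
  rewrite linearZ /= dH_delta forest_dH_pi scaler_sumr; apply: eq_bigr => u _.
  by rewrite -graph_deltaE.
rewrite push_wf; under [RHS]eq_bigr do rewrite scaler_suml.
rewrite !pair_big_dep /=.
rewrite [RHS](reindex_onto (fun x => (graph_graft x.1 x.2, root x.1 ord_max))
  (fun y => (cut y.1 y.2, odflt y.2 (target y.1 y.2)))) /=.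
  apply: eq_big => [[g u]|[g u] /= /andP[wg _]] /=.
    rewrite !andbT !ffunE !eqxx andbT /=; apply/idP/idP => [wg|/andP[wg /eqP[gE]]].
      have /wfP[_ rE _] := wg.
      rewrite graph_graft_wf //= cut_graft ?eqxx //.
      by apply/eqP; rewrite -rE codom_f.
    by rewrite -gE cut_wf // ffunE eqxx.
  have /wfP[_ rE _] := wg.
  by rewrite cut_graft //; apply/eqP; rewrite -rE codom_f.
move=> [g w] /= /andP[wg tw]; rewrite ffunE unlift_none.
by case tE: (target g w) tw => [u|] //= _; rewrite graft_cut.
Qed.

Lemma cut_sum_iso (A : graph N n.+1 p -> R) :
  iso_invariant A -> iso_invariant (cut_sum A).
Proof.
move=> invA s g h wg wh sgh; have /isomapP[tE rE cE] := sgh.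
rewrite /cut_sum [RHS](reindex_inj (@perm_inj _ s)).
apply: eq_big => [w|w tw]; first by rewrite tE; case: (target g w).
apply: (invA s); rewrite ?cut_wf //; first by rewrite tE; case: (target g w) tw.
apply/isomapP; split=> //= [x|i]; rewrite !ffunE.
  by rewrite (inj_eq perm_inj); case: ifP.
by case: (unlift _ i).
Qed.
End HorizontalTransfer.

Lemma dH_dH n p (a : span R N n.+2 p) : a \in Omega R N n.+2 p -> dH (dH a) = 0.
Proof.
move=> /spread_alt alta; rewrite -[a]spreadK !dH_push /push big1 // => g _.
by rewrite cut_sum_cut_sum // scale0r.
Qed.

(** The nodes are treated in a fixed order by [cut_sum_exact], so [B] may change
    under isomorphism; [push] turns it into a form and commutes with d_H. *)
Lemma horizontal_exactness n p (a : span R N n.+1 p) : (1 < N)%N ->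
  a \in Omega R N n.+1 p -> dH a \in loop_span R N n p ->
  exists2 b, b \in Omega R N n.+2 p & dH b - a \in loop_span R N n.+1 p.
Proof.
move=> N1 /spread_alt alta la.
have [|B altB BE] := cut_sum_exact N1 alta.
  move=> g; apply: push_loop_inv; first exact/cut_sum_iso/spread_iso.
  by rewrite -dH_push spreadK.
exists (push B); first exact: push_Omega.
rewrite dH_push -[a]spreadK -pushB; apply: push_loop => g gg.
by rewrite BE // subrr.
Qed.
End Transfer.

(** * The vertical differential on functions *)

Section VerticalTransfer.
Variables (R : realType) (N : nat).

(** The full alternation over S_p, not normalised; it links the alternation in
    [dV] to the shorter sum [uncov_sum]. *)
Definition alt_sum n p (F : graph N n p -> R) (g : graph N n p) : R :=
  \sum_(s : 'S_p) (-1) ^+ s * F (graph_actC s g).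

Section AltSum.
Variables n p : nat.

Lemma fact_neq0 m : m`!%:R != 0 :> R.
Proof. by rewrite pnatr_eq0 -lt0n fact_gt0. Qed.

Lemma alt_sum_act (F : graph N n p -> R) t g :
  alt_sum (fun g => F (graph_actC t g)) g = (-1) ^+ t * alt_sum F g.
Proof.
rewrite /alt_sum mulr_sumr [RHS](reindex_inj (mulIg t)) /=; apply: eq_bigr => s _.
rewrite graph_actCM odd_permM signr_addb -mulrA [RHS]mulrCA; congr (_ * _).
by rewrite signrMK.
Qed.

Lemma alt_sum_id (F : graph N n p -> R) g :
  (forall s g, F (graph_actC s g) = (-1) ^+ s * F g) -> alt_sum F g = p`!%:R * F g.
Proof.
move=> FC; rewrite /alt_sum (eq_bigr (fun=> F g)) => [|s _].
  by rewrite sumr_const card_Sn mulr_natl.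
by rewrite FC signrMK.
Qed.

Lemma altC_push (F : graph N n p -> R) : altC (push F) = p`!%:R^-1 *: push (alt_sum F).
Proof.
rewrite /altC; congr (_ *: _); rewrite /alt_sum push_sum.
rewrite [RHS](reindex_inj invg_inj) /=; apply: eq_bigr => s _.
by rewrite spanC_push pushZ odd_permV.
Qed.
End AltSum.

(** Each of the p + 1 terms of [uncov_sum] is a renumbering of the same function
    with its sign, and alternation turns it into the alternation of that
    function. *)
Lemma alt_sum_uncov_sum n p (A : graph N n p -> R) g :
  alt_sum (uncov_sum A) g = p.+1%:R * alt_sum (fun g => A (uncov g)) g.
Proof.
transitivity (\sum_(k < p.+1) alt_sum (fun g => A (uncov g)) g); last first.
  by rewrite sumr_const card_ord mulr_natl.
rewrite {1}/alt_sum; under eq_bigr do rewrite mulr_sumr.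
rewrite exchange_big; apply: eq_bigr => k _ /=.
rewrite -[RHS]/(alt_sum (fun g => A (uncov g)) g).
transitivity ((-1) ^+ (k != ord_max) * ((-1) ^+ (tperm k ord_max) *
  alt_sum (fun g => A (uncov g)) g)).
  rewrite -alt_sum_act /alt_sum mulr_sumr; apply: eq_bigr => s _; exact: mulrCA.
by rewrite sign_tperm signrMK.
Qed.

(** The p! permutations in a coset contribute equally to the full alternation.
    Alternating [uncov_sum A] in two ways proves it without enumerating the
    cosets. *)
Lemma uncov_sumE n p (A : graph N n p -> R) g : alternating A ->
  p`!%:R * uncov_sum A g = alt_sum (fun g => A (uncov g)) g.
Proof.
move=> altA; have [_ aC] := uncov_sum_alt altA.
apply: (mulfI (_ : p.+1%:R != 0)); first by rewrite pnatr_eq0.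
by rewrite -alt_sum_uncov_sum alt_sum_id // mulrA -natrM -factS.
Qed.

Lemma uncov_uncov_swap n p (g : graph N n p.+2) :
  uncov (uncov (graph_actC (tperm (lift ord_max ord_max) ord_max) g)) = uncov (uncov g).
Proof.
apply: graph_eq => // i; rewrite !ffunE tpermV.
by rewrite tpermD ?neq_lift // (inj_eq lift_inj) neq_lift.
Qed.

(** Alternated, this is a multiple of the alternation of
    [fun h => A (uncov (uncov h))], which is symmetric in the last two
    covertex numbers. *)
Lemma uncov_sum_uncov_sum n p (A : graph N n p -> R) g : alternating A ->
  uncov_sum (uncov_sum A) g = 0.
Proof.
move=> altA; have altU := uncov_sum_alt altA.
apply: (mulfI (fact_neq0 p.+1)); rewrite mulr0 uncov_sumE //.
pose F (h : graph N n p.+2) := A (uncov (uncov h)).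
transitivity (\sum_(k < p.+1) alt_sum F g).
  rewrite {1}/alt_sum; under eq_bigr do rewrite mulr_sumr.
  rewrite exchange_big; apply: eq_bigr => k _ /=.
  rewrite -[RHS]/(alt_sum F g).
  transitivity ((-1) ^+ (k != ord_max) *
      ((-1) ^+ (lift_perm ord_max ord_max (tperm k ord_max)) * alt_sum F g)).
    rewrite -alt_sum_act /alt_sum mulr_sumr; apply: eq_bigr => s _.
    by rewrite mulrCA /F uncov_lift.
  by rewrite sign_lift sign_tperm signrMK.
have F0 : alt_sum F g = 0.
  apply/eqP; rewrite -eqNr -mulN1r; apply/eqP.
  have <- : (-1) ^+ (tperm (lift ord_max ord_max) (@ord_max p.+1)) = -1 :> R.
    by rewrite sign_tperm eq_sym neq_lift.
  rewrite -alt_sum_act; apply: eq_bigr => s _.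
  by rewrite /F uncov_uncov_swap.
by rewrite big1.
Qed.

Lemma altR_id n p (a : span R N n p) : a \in Omega R N n p -> altR a = a.
Proof.
case/OmegaP=> aR _; rewrite /altR (eq_bigr (fun=> a)) => [|s _]; last by rewrite aR sgnK.
by rewrite sumr_const card_Sn -scaler_nat scalerA mulVf ?scale1r // fact_neq0.
Qed.

(** A graph with p + 1 covertices is a graph with p covertices together
    with the vertex that becomes the last one; so before alternation
    d_V pulls [A] back along [uncov]. *)
Lemma dV_push n p (A : graph N n p -> R) : alternating A ->
  dV (push A) = p.+1%:R^-1 *: push (uncov_sum A).
Proof.
move=> altA.
have -> : dV (push A) = wedge (push (fun g => A (uncov g))).
  rewrite push_lforest linear_sum.
  have -> : \sum_(g : lforest N n p) dV (A g *: delta (fclass g)) =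
      wedge (\sum_(g : graph N n p | wf g) \sum_(v | v \notin codom (covertex g))
        A g *: graph_delta R (mkcov_at g v)).
    rewrite (reindex_omap (@lgraph N _ p) (insub : _ -> option (lforest N _ p))) /=;
      last by move=> g wg; rewrite insubT.
    rewrite linear_sum; apply: eq_big => [g|g _]; first by rewrite lgraph_wf insub_lgraph eqxx.
    rewrite linearZ /= dV_delta forest_dV_pi -linearZ -scaler_sumr; congr (wedge (_ *: _)).
    rewrite [RHS](reindex_omap (val : vertex g -> 'I_N) insub) /=; last first.
      by move=> v vN; rewrite insubT.
    apply: eq_big => [v|v _]; first by rewrite (valP v) valK eqxx.
    by rewrite -graph_deltaE.
  congr wedge; rewrite push_wf pair_big_dep /=.
  rewrite [LHS](reindex_onto (fun g => (uncov g, covertex g ord_max))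
    (fun x => mkcov_at x.1 x.2)) /=; last first.
    by move=> [g v] /= _; rewrite uncovK ffunE unlift_none.
  apply: eq_big => [g|g _]; rewrite mkcov_uncov ?eqxx ?andbT //.
  apply/andP/idP=> [[wg vN]|wg].
    by rewrite -[g]mkcov_uncov mkcov_at_wf.
  by rewrite uncov_wf // covertex_max_notin.
rewrite /wedge altC_push.
have -> : push (alt_sum (fun g => A (uncov g))) = p`!%:R *: push (uncov_sum A).
  by rewrite -pushZ; apply: eq_push => g _; rewrite uncov_sumE.
rewrite scalerA factS natrM invfM -mulrA mulVf ?fact_neq0 // mulr1 linearZ; congr (_ *: _).
by apply/altR_id/push_Omega/uncov_sum_alt.
Qed.

Lemma uncov_sum_iso n p (A : graph N n p -> R) :
  iso_invariant A -> iso_invariant (uncov_sum A).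
Proof.
move=> invA s g h wg wh sgh; apply: eq_bigr => k _; congr (_ * _).
apply: (invA s); rewrite ?uncov_wf ?actC_wfE //.
have /isomapP[tE rE cE] := isomap_actC (tperm k ord_max) sgh.
by apply/isomapP; split=> // i; move: (cE (lift ord_max i)); rewrite /= !ffunE.
Qed.

Lemma dV_dV n p (a : span R N n p) : a \in Omega R N n p -> dV (dV a) = 0.
Proof.
move=> /spread_alt alta; rewrite -[a]spreadK dV_push // linearZ /=.
rewrite dV_push; last exact: uncov_sum_alt.
rewrite /push big1 ?scaler0 // => g _.
by rewrite uncov_sum_uncov_sum // scale0r.
Qed.

Section Kernel.
Variables n p : nat.
Variable a : span R N n p.
Hypotheses (aO : a \in Omega R N n p) (la : dV a \in loop_span R N n p.+1).

Lemma uncov_sum_kernel g : loop_free g -> uncov_sum (spread a) g = 0.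
Proof.
apply: push_loop_inv; first exact/uncov_sum_iso/spread_iso.
have := la; rewrite -{1}[a]spreadK dV_push; last exact: spread_alt.
by move/(memvZ p.+1%:R); rewrite scalerA mulfV ?scale1r // pnatr_eq0.
Qed.

Lemma mkcov_uncov_kernel g : loop_free g -> mkcov_sum (uncov_sum (spread a)) g = 0.
Proof.
case/andP=> wg lg; rewrite /mkcov_sum big1 // => v vN.
by rewrite uncov_sum_kernel // /loop_free mkcov_at_wf.
Qed.
End Kernel.

Lemma vertical_injectivity n (a : span R N n 0) : (0 < N)%N ->
  a \in Omega R N n 0 -> dV a \in loop_span R N n 1 -> a \in loop_span R N n 0.
Proof.
move=> N0 aO la; rewrite -[a]spreadK; apply: push_loop => g gg.
have /andP[wg _] := gg.
have /eqP := vertical_homotopy0 (spread a) wg.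
rewrite (mkcov_uncov_kernel aO la gg) eq_sym mulf_eq0 pnatr_eq0 -leqn0 leqNgt N0.
by move/eqP.
Qed.

Lemma vertical_exactness n p (a : span R N n p.+1) : (0 < N)%N ->
  a \in Omega R N n p.+1 -> dV a \in loop_span R N n p.+2 ->
  exists2 b, b \in Omega R N n p & dV b - a \in loop_span R N n p.+1.
Proof.
move=> N0 aO la; have alta := spread_alt aO.
have altm := mkcov_sum_alt alta.
have NR : N%:R != 0 :> R by rewrite pnatr_eq0 -lt0n.
have pR : p.+1%:R != 0 :> R by rewrite pnatr_eq0.
exists ((p.+1%:R / N%:R) *: push (mkcov_sum (spread a))).
  exact/memvZ/push_Omega.
rewrite linearZ /= dV_push // scalerA mulrAC mulfV // mul1r -[a in _ - a]spreadK.
rewrite -pushZ -pushB; apply: push_loop => g gg; have /andP[wg _] := gg.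
have := vertical_homotopy wg alta; rewrite (mkcov_uncov_kernel aO la gg) add0r => ->.
by rewrite mulKf // subrr.
Qed.

Lemma pi_eq0 n p (a : subvs_of (Omega R N n p)) :
  ((\pi_(DFOmega R N n p) a)%qT == 0) = (vsval a \in loop_span R N n p).
Proof.
have -> : 0 = (\pi_(DFOmega R N n p) 0)%qT.
  by apply/esym; exact: (raddf0 (\pi_(Quotient.quot (@loop_forms R N n p)))%qT).
by rewrite DFOmega_eq [vsval 0]raddf0 subr0.
Qed.
End VerticalTransfer.

(** * Exactness for more than one node *)

Lemma bicomplex_exact_gt1 (R : realType) N : (1 < N)%N -> bicomplex_exact R N.
Proof.
move=> N1; have N0 := ltnW N1; split=> [n p a|n].
  elim/DFOmega_ind: a => a; rewrite df_dH_pi; split=> [[b]|/eqP].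
    elim/DFOmega_ind: b => b /eqP; rewrite df_dH_pi DFOmega_eq /= => ba.
    apply/eqP; rewrite pi_eq0 /=.
    have := dH_loop ba; rewrite linearB /= dH_dH ?subvsP // sub0r.
    by rewrite memvN.
  rewrite pi_eq0 /= => /(horizontal_exactness N1 (subvsP a))[b bO ba].
  exists (\pi_(DFOmega R N n.+2 p) (Subvs bO))%qT; rewrite df_dH_pi.
  by apply/eqP; rewrite DFOmega_eq.
split=> [|p a].
  suff K (x : DFOmega R N n 0) : df_dV x = 0 -> x = 0 by apply: raddf_inj K.
  elim/DFOmega_ind: x => a /eqP.
  rewrite df_dV_pi pi_eq0 /= => /(vertical_injectivity N0 (subvsP a)) la.
  by apply/eqP; rewrite pi_eq0.
elim/DFOmega_ind: a => a; rewrite df_dV_pi; split=> [[b]|/eqP].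
  elim/DFOmega_ind: b => b /eqP; rewrite df_dV_pi DFOmega_eq /= => ba.
  apply/eqP; rewrite pi_eq0 /=.
  have := dV_loop ba; rewrite linearB /= dV_dV ?subvsP // sub0r.
  by rewrite memvN.
rewrite pi_eq0 /= => /(vertical_exactness N0 (subvsP a))[b bO ba].
exists (\pi_(DFOmega R N n p) (Subvs bO))%qT; rewrite df_dV_pi.
by apply/eqP; rewrite DFOmega_eq.
Qed.

(** * The obstruction with one node *)

Definition one_root : graph 1 1 0 :=
  Graph [ffun=> None] [ffun=> ord0] [ffun=> ord0].

Lemma one_root_wf : wf one_root.
Proof.
apply/wfP; split=> [i j _|v|[]//]; first by rewrite !ord1.
by rewrite ffunE eqxx; apply/codomP; exists ord0; rewrite ffunE ord1.
Qed.

Lemma two_root_form_eq0 (R : realType) (b : span R 1 2 0) : b = 0.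
Proof.
apply/ffunP; elim/forest_ind=> g; have /wfP[ri _ _] := lgraph_wf g.
by have /ri := etrans (ord1 (root g ord0)) (esym (ord1 (root g ord_max))).
Qed.

(** Grafting the only node produces a 1-loop, so the one-node forest is a cycle;
    it is not a boundary, as there are no forests with two roots. *)
Lemma bicomplex_not_exact_1 (R : realType) : ~ bicomplex_exact R 1.
Proof.
case=> /(_ 0%N 0%N) H _.
pose g := LForest one_root_wf.
have aO : delta (fclass g) \in Omega R 1 1 0.
  have S1 m (s : 'S_m) : (m <= 1)%N -> s = 1%g.
    move=> m1; apply/permP=> i; rewrite perm1; apply/val_inj => /=.
    by case: m m1 s i => [|[|]] // _ s; [case|move=> i; rewrite !ord1].
  apply/OmegaP; split=> s; rewrite (S1 _ s) // odd_perm1 scale1r.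
    rewrite spanR_delta actR_pi; congr (delta (fclass _)); apply: val_inj.
    exact: graph_actR1.
  rewrite spanC_delta actC_pi; congr (delta (fclass _)); apply: val_inj.
  exact: graph_actC1.
have [_] := H (\pi_(DFOmega R 1 1 0) (Subvs aO))%qT.
case=> [|b].
  rewrite df_dH_pi; apply/eqP; rewrite pi_eq0 /= dH_delta forest_dH_pi.
  rewrite memv_suml // => u _; rewrite delta_loop // has_loop_pi.
  by apply/existsP; exists ord0; rewrite ffunE !ord1 eqxx.
elim/DFOmega_ind: b => b /eqP; rewrite df_dH_pi DFOmega_eq /=.
rewrite (two_root_form_eq0 (vsval b)) linear0 sub0r memvN => /loop_spanP/(_ (fclass g)).
rewrite has_loop_pi delta.unlock ffunE eqxx => /(_ _)/eqP; rewrite oner_eq0.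
move=> F; suff: false by []; apply: F.
by apply/existsP=> -[v]; rewrite ffunE.
Qed.

Theorem theorem2p10 (R : realType) (N : nat) (hN : (1 <= N)%N) :
  bicomplex_exact R N <-> N <> 1%N.
Proof.
split=> [ex N1|N1]; first by rewrite N1 in ex; apply: bicomplex_not_exact_1 ex.
by apply: bicomplex_exact_gt1; rewrite ltn_neqAle hN andbT eq_sym; apply/eqP.
Qed.
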